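(* Let $\{\rho_n\}_{n\ge 1}$ be the sequence of symmetric densities of a binary branching Brownian motion $\{X_k(t),\ k\in\{1,\dots,\mathtt{n}(t)\}\}_{t\ge 0}$ on $\mathbb{R}$ started from a single particle at the origin with branching rate one, i.e. for $n\ge 1$, $t\ge 0$, $$\int_A \rho_n(t,y_1,\dots,y_n)\,dy_1\cdots dy_n=\mathbb{P}\left(\{\mathtt{n}(t)=n\}\cap\{(X_1(t),\dots,X_n(t))\in A\}\right),\qquad A\in\mathcal{B}(\mathbb{R}^n).$$ Then the average concentration field $$c(t,x)=\sum_{n\ge 1}n\int_{\mathbb{R}^{n-1}}\rho_n(t,y_1,\dots,y_{n-1},x)\,dy_1\cdots dy_{n-1},\qquad t\ge 0,\ x\in\mathbb{R},$$ solves the reaction-diffusion partial differential equation $$\begin{cases} \partial_t c(t,x)=\frac12\partial_x^2c(t,x)+c(t,x), & t>0,\ x\in\mathbb{R};\\ c(0,x)=\delta_0(x), & x\in\mathbb{R}, \end{cases}$$ where $\delta_0$ is the Dirac delta at the origin.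
   Context: Binary branching Brownian motion: at time zero a single particle starts at the origin and performs standard Brownian motion in $\mathbb{R}$; after an exponential time $\tau$ of parameter one (independent of the motion) it splits into two identical, independent copies of itself, which start Brownian motion at the position of the parent at time $\tau$; the procedure is repeated independently ad infinitum. $\mathtt{n}(t)$ is the number of particles alive at time $t$ and $X_1(t),\dots,X_{\mathtt{n}(t)}(t)$ are their positions. Particles are indistinguishable: the labelling is such that each $\rho_n(t,\cdot)$ is symmetric in its $n$ arguments (e.g. living particles are labelled uniformly at random). The sequence $\{\rho_n\}_{n\ge1}$ satisfies $\sum_{n\ge 1}\int_{\mathbb{R}^n}\rho_n(t,y_1,\dots,y_n)\,dy_1\cdots dy_n=1$ for all $t\ge0$ and solves the system $$\partial_t\rho_n=\frac12\sum_{k,l=1}^n\partial^2_{y_ky_l}\rho_n+\sum_{k=1}^{n-1}\rho_k\hat\otimes\rho_{n-k}-\rho_n\quad(n\ge1,\ t>0),\qquad \rho_1(0,\cdot)=\delta_0,\quad \rho_n(0,\cdot)=0\ (n\ge2),$$ where $(\rho_k\hat\otimes\rho_{n-k})(t,y_1,\dots,y_n)$ is the symmetric tensor product, i.e. the average over all permutations $\sigma$ of $\{1,\dots,n\}$ of $\rho_k(t,y_{\sigma(1)},\dots,y_{\sigma(k)})\,\rho_{n-k}(t,y_{\sigma(k+1)},\dots,y_{\sigma(n)})$; $c$ is called the average concentration field associated with this system. Conventions: densities are identified up to Lebesgue-null sets (so $c(t,\cdot)$ is determined for almost every $x$), for $n=1$ the integral over $\mathbb{R}^{0}$ is just $\rho_1(t,x)$,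 and the equations are understood in the sense of distributions in the space variables, with the initial datum $\delta_0$ attained in that sense. *)

(* Defs.v *)
From HB Require Import structures.
From mathcomp Require Import all_boot all_order all_algebra all_fingroup.
From mathcomp Require Import all_classical all_reals all_analysis.

Set Implicit Arguments.
Unset Strict Implicit.
Unset Printing Implicit Defensive.

Import Order.TTheory GRing.Theory Num.Theory.
Import numFieldTopology.Exports numFieldNormedType.Exports.

Local Open Scope classical_set_scope.
Local Open Scope ring_scope.

(** Lebesgue measure on [n.-tuple R], i.e. on R^n: iterated product of the
    one-dimensional Lebesgue measure, transported along
    [R * R^n ~ R^(n+1)]; on R^0 it is the Dirac mass. *)

Section lebesgue_cons.
Context (R : realType) (n : nat).
Variable m : {sigma_finite_measure set (n.-tuple R) -> \bar R}.

Definition tuple_cons (z : R * n.-tuple R) : n.+1.-tuple R :=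
  [tuple of z.1 :: z.2].

Definition lebesgue_cons : set (n.+1.-tuple R) -> \bar R :=
  pushforward (lebesgue_measure \x m)%E
    (tuple_cons : measurableTypeR R * n.-tuple R -> n.+1.-tuple R).

Let measurable_tuple_cons :
  measurable_fun setT (tuple_cons : measurableTypeR R * n.-tuple R -> _).
Proof. by apply: (@measurable_cons _ _ _ _ fst n snd). Qed.

Let tuple_uncons (y : n.+1.-tuple R) : measurableTypeR R * n.-tuple R :=
  (thead y, [tuple of behead y]).

Let measurable_tuple_uncons : measurable_fun setT tuple_uncons.
Proof.
apply/measurable_fun_pair => /=; first exact: measurable_tnth.
exact: measurable_behead.
Qed.

Let lebesgue_cons0 : lebesgue_cons set0 = 0%E.
Proof. by rewrite /lebesgue_cons /pushforward preimage_set0 measure0. Qed.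

Let lebesgue_cons_ge0 A : (0 <= lebesgue_cons A)%E.
Proof. exact: measure_ge0. Qed.

Let lebesgue_cons_sigma_additive : semi_sigma_additive lebesgue_cons.
Proof.
exact: (@measure_semi_sigma_additive _ _ _
  (measure_function_pushforward__canonical__measure_function_Measure
     (lebesgue_measure \x m)%E measurable_tuple_cons)).
Qed.

HB.instance Definition _ := isMeasure.Build _ _ _ lebesgue_cons
  lebesgue_cons0 lebesgue_cons_ge0 lebesgue_cons_sigma_additive.

Let lebesgue_cons_sigma_finite : sigma_finite setT lebesgue_cons.
Proof.
have /sigma_finiteP[G [GT Gnd Goo]] := sigma_finiteT m.
have /sigma_finiteP[F [FT Fnd Foo]] := sigma_finiteT (@lebesgue_measure R).
exists (fun k => tuple_uncons @^-1` (F k `*` G k)).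
  rewrite -preimage_bigcup; apply/esym/seteqP; split=> // y _ /=.
  have : [set: measurableTypeR R] (tuple_uncons y).1 by [].
  have : [set: n.-tuple R] (tuple_uncons y).2 by [].
  rewrite FT GT => -[j _ Gj] [i _ Fi]; exists (maxn i j) => //; split.
    by move: Fi; apply/subsetPset/Fnd/leq_maxl.
  by move: Gj; apply/subsetPset/Gnd/leq_maxr.
move=> k; have [mF Fk] := Foo k; have [mG Gk] := Goo k; split.
  have := measurable_tuple_uncons measurableT (measurableX mF mG).
  by rewrite setTI.
rewrite /lebesgue_cons /pushforward -comp_preimage.
rewrite (_ : _ @^-1` _ = F k `*` G k); last first.
  suff uncK z : tuple_uncons (tuple_cons z) = z.
    by rewrite (_ : _ \o _ = id) ?preimage_id//; apply/funext => z; exact: uncK.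
  case: z => x y; rewrite /tuple_uncons /tuple_cons/= theadE.
  by congr pair; exact/val_inj.
by rewrite product_measure1E// lte_mul_pinfty// ge0_fin_numE.
Qed.

HB.instance Definition _ := Measure_isSigmaFinite.Build _ _ _ lebesgue_cons
  lebesgue_cons_sigma_finite.

End lebesgue_cons.

Fixpoint lebesgue_tuple (R : realType) (n : nat) :
    {sigma_finite_measure set (n.-tuple R) -> \bar R} :=
  match n with
  | 0 => \d_([tuple] : 0.-tuple R)
  | n'.+1 => lebesgue_cons (lebesgue_tuple R n')
  end.

Section probability_notions.
Context d (Omega : measurableType d) (R : realType) (P : probability Omega R).

(** Mutual independence of a family of classes of events. *)
Definition mutually_independent (I : eqType) (G : I -> set (set Omega)) :=
  forall (s : seq I) (E : I -> set Omega),
    uniq s -> (forall i, i \in s -> G i (E i)) ->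
    P (\bigcap_(i in [set` s]) E i) = (\prod_(i <- s) P (E i))%E.

Definition sigma_rv (Y : Omega -> R) : set (set Omega) :=
  preimage_set_system setT Y measurable.

Definition sigma_process (W : R -> Omega -> R) : set (set Omega) :=
  <<s \bigcup_(t in [set t : R | 0 <= t]) sigma_rv (W t) >>.

(** Only the times [t >= 0] of [W] are meaningful. *)
Record standard_brownian_motion (W : R -> Omega -> R) : Prop := {
  bm_measurable : forall t, 0 <= t -> measurable_fun setT (W t) ;
  bm_start : {ae P, forall w, W 0 w = 0} ;
  bm_continuous : forall w, {within `[0, +oo[, continuous (W ^~ w)} ;
  bm_gaussian : forall s t, 0 <= s -> s < t ->
    forall A : set R, measurable A ->
    P [set w | A (W t w - W s w)] = normal_prob 0 (Num.sqrt (t - s)) A ;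
  bm_indep_increments : forall s : nat -> R,
    0 <= s 0%N -> nondecreasing_seq s ->
    mutually_independent (fun k => sigma_rv (W (s k.+1) \- W (s k)))
}.

(** Binary branching Brownian motion with branching rate one.  Particles are
    named by finite binary words: the initial particle is [[::]] and the two
    children of [u] are [rcons u false] and [rcons u true], so that the
    ancestors of [u] are the [take k u] for [k < size u].  Particle [u] lives
    for a time [tau u], during which its displacement from its place of birth
    is given by the Brownian motion [W u], run from time 0. *)
Record binary_branching_bm (tau : seq bool -> Omega -> R)
    (W : seq bool -> R -> Omega -> R) : Prop := {
  bbm_lifetime_measurable : forall u, measurable_fun setT (tau u) ;
  bbm_lifetime_exponential : forall u (A : set R), measurable A ->
    P [set w | A (tau u w)] = exponential_prob 1 A ;
  bbm_motion : forall u, standard_brownian_motion (W u) ;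
  bbm_independent : mutually_independent
    (fun i : seq bool + seq bool =>
       match i with
       | inl u => sigma_rv (tau u)
       | inr u => sigma_process (W u)
       end)
}.

End probability_notions.

Section population.
Context (Omega : Type) (R : realType).
Variables (tau : seq bool -> Omega -> R) (W : seq bool -> R -> Omega -> R).

Definition birth_time (u : seq bool) (w : Omega) : R :=
  \sum_(k < size u) tau (take k u) w.

Definition alive (t : R) (w : Omega) : set (seq bool) :=
  [set u | birth_time u w <= t < birth_time u w + tau u w].

Definition particle_position (u : seq bool) (t : R) (w : Omega) : R :=
  \sum_(k < size u) W (take k u) (tau (take k u) w) w
  + W u (t - birth_time u w) w.

(** The event [n(t) = n]. *)
Definition population_eq (t : R) (n : nat) : set Omega :=
  [set w | (alive t w #= `I_n)%card].

(** [X k t], for [k < n(t)], are the positions of the particles alive at time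
    [t], enumerated in some order that may depend on [t] and on chance
    (labels start at 0). *)
Definition labels_particles (X : nat -> R -> Omega -> R) :=
  forall (t : R) (w : Omega) (n : nat), 0 <= t -> population_eq t n w ->
  exists2 l : nat -> seq bool, set_bij `I_n (alive t w) l &
    forall k, (k < n)%N -> X k t w = particle_position (l k) t w.

End population.

(** [rho n t] is a symmetric density of the law of the [n] positions at time
    [t] on the event [n(t) = n].  At [t = 0] this law is a Dirac mass, which
    has no density; hence the restriction to [0 < t]. *)
Record symmetric_densities d (Omega : measurableType d) (R : realType)
    (P : probability Omega R) (tau : seq bool -> Omega -> R)
    (X : nat -> R -> Omega -> R) (rho : forall n, R -> n.-tuple R -> R)
    : Prop := {
  density_measurable : forall n t, (0 < n)%N -> 0 < t ->
    measurable_fun setT (rho n t) ;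
  density_ge0 : forall n t y, (0 < n)%N -> 0 < t -> 0 <= rho n t y ;
  density_symmetric : forall n t, (0 < n)%N -> 0 < t ->
    forall s : 'S_n, {ae lebesgue_tuple R n, forall y,
      rho n t [tuple tnth y (s i) | i < n] = rho n t y} ;
  density_law : forall n t, (0 < n)%N -> 0 < t ->
    forall A : set (n.-tuple R), measurable A ->
    (\int[lebesgue_tuple R n]_(y in A) (rho n t y)%:E)%E =
    P (population_eq tau t n `&` [set w | A [tuple X i t w | i < n]])
}.

Definition average_concentration (R : realType)
    (rho : forall n, R -> n.-tuple R -> R) (t x : R) : \bar R :=
  (\sum_(0 <= m <oo) m.+1%:R%:E *
     \int[lebesgue_tuple R m]_y (rho m.+1 t [tuple of rcons y x])%:E)%E.

Section weak_solution.
Context (R : realType).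

(** Smooth functions with compact support. *)
Definition test_function (phi : R -> R) :=
  (forall n x, derivable (derive1n n phi) x 1) /\
  compact (closure [set x | phi x != 0]).

Definition pairing (f : R -> \bar R) (phi : R -> R) : R :=
  fine (\int[lebesgue_measure]_x (f x * (phi x)%:E))%E.

(** [c] solves [d_t c = 1/2 d_x^2 c + c] for [t > 0] with initial datum
    [delta_0], in the sense of distributions in the space variable. *)
Definition solves_reaction_diffusion (c : R -> R -> \bar R) :=
  [/\ forall t, 0 < t -> forall K : set R, compact K ->
        lebesgue_measure.-integrable K (c t),
      forall phi, test_function phi -> forall t : R, 0 < t ->
        is_derive t 1 (fun s => pairing (c s) phi)
          (2^-1 * pairing (c t) (derive1n 2 phi) + pairing (c t) phi) &
      forall phi, test_function phi ->
        pairing (c t) phi @[t --> 0^'+] --> phi 0 ].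

End weak_solution.

(* Main.v *)
Require Import Defs.
From HB Require Import structures.
From mathcomp Require Import all_boot all_order all_algebra all_fingroup.
From mathcomp Require Import all_classical all_reals all_analysis.
From mathcomp Require Import measurable_realfun.
From mathcomp Require Import ring lra.

(** By linearity of expectation, for [t > 0] and [g >= 0] bounded continuous,
    [\int c(t, x) g(x) dx] is the sum over all words [u] of
    [E[g(position of u at time t); u alive at time t]].  The lifetimes are
    independent of the motions, and given that [u] is alive at time [t] the
    durations of the successive motions along its line of descent sum up to
    [t], so that each term factors as [P(u alive at t) * E[g(N(0, t))]].  Here
    [P(u alive at t)] is the Poisson weight [e^-t t^n / n!] with [n = size u],
    and summing over the [2^n] words of each size gives
    [\int c(t, x) g(x) dx = e^t E[g(N(0, t))]].  The equation follows from the
    heat semigroup, whose generator is computed from the first three moments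
    of the Gaussian law. *)

Set Implicit Arguments.
Unset Strict Implicit.
Unset Printing Implicit Defensive.

Import Order.TTheory GRing.Theory Num.Theory.
Import numFieldTopology.Exports numFieldNormedType.Exports.

Local Open Scope classical_set_scope.
Local Open Scope ring_scope.

(** The obstacle is that a position evaluates each motion at a random duration, while the hypotheses
    describe the law of [W] at deterministic times only. Once the lifetimes are discretised,
    durations are constant on each cell and independence applies; the resulting identity is exact at
    every mesh, so that only the integrand has to converge. This is where continuity of the paths
    and bounded continuous [g] enter. The semigroup law of [heat] is read off the increments of a
    Brownian motion, which avoids computing a Gaussian convolution. Signed test functions are
    reached by adding a constant, which is legitimate because [g = 1] shows that [c] has finite
    mass. *)

(** * Integration against a density *)

Section density.
Local Open Scope ereal_scope.
Context d (T : measurableType d) (R : realType).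
Variables (m1 m2 : {measure set T -> \bar R}) (g : T -> R).
Hypothesis mg : measurable_fun setT g.
Hypothesis g0 : forall x, (0 <= g x)%R.
Hypothesis m2E : forall A, measurable A -> m2 A = \int[m1]_(x in A) (g x)%:E.

Import HBNNSimple.

(** Indicators, then simple functions by linearity, then monotone limits. Besides Gaussian and
    exponential laws, it serves for restricted measures, whose density is an indicator. *)
Lemma ge0_integral_density (f : T -> \bar R) : measurable_fun setT f ->
  (forall x, 0 <= f x) -> \int[m2]_x f x = \int[m1]_x (f x * (g x)%:E).
Proof.
move=> mf f0.
have mgE : measurable_fun setT (EFin \o g) by exact/measurable_EFinP.
have indE E : measurable E ->
    \int[m2]_x (\1_E x)%:E = \int[m1]_x ((\1_E x)%:E * (g x)%:E).
  move=> mE; rewrite integral_indic// setIT m2E// integral_mkcond.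
  apply: eq_integral => x _; rewrite patchE indicE.
  by case: ifPn => xE; rewrite ?mul1e ?mul0e.
have nnE (h : {nnsfun T >-> R}) :
    \int[m2]_x (h x)%:E = \int[m1]_x ((h x)%:E * (g x)%:E).
  under [LHS]eq_integral do rewrite fimfunE -fsumEFin//.
  rewrite [LHS]ge0_integral_fsum//; last 2 first.
    - by move=> r; exact/measurable_EFinP/measurableT_comp.
    - by move=> n x _; rewrite EFinM nnfun_muleindic_ge0.
  under [RHS]eq_integral.
    move=> x xD; rewrite fimfunE -fsumEFin// ge0_mule_fsuml; last first.
      by move=> r; rewrite EFinM nnfun_muleindic_ge0.
    over.
  rewrite [RHS]ge0_integral_fsum//; last 2 first.
    - move=> r; apply: emeasurable_funM => //.
      by apply/measurable_EFinP; exact/measurableT_comp.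
    - by move=> n x _; rewrite EFinM mule_ge0// ?nnfun_muleindic_ge0// lee_fin.
  apply: eq_fsbigr => r _; rewrite integralZl_indic_nnsfun// indE//.
  (* The scalar [r] enters the integral only if it is nonnegative; a negative level of a nonnegative
     function has empty preimage. *)
  have [r0|r0] := ltP r 0%R.
    rewrite preimage_nnfun0// indic0 !integral0_eq ?mule0//.
      by move=> x _; rewrite mulr0 mul0e.
    by move=> x _; rewrite mul0e.
  rewrite -ge0_integralZl//.
  - by apply: eq_integral => x _; rewrite EFinM muleA.
  - by apply: emeasurable_funM => //; exact/measurable_EFinP.
  - by move=> x _; rewrite mule_ge0// lee_fin.
pose f_ := nnsfun_approx measurableT mf.
transitivity (limn (fun n => \int[m2]_x (f_ n x)%:E)).
  rewrite -monotone_convergence//=.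
  - apply: eq_integral => x /[!inE] xD; apply/esym/cvg_lim => //=.
    exact: cvg_nnsfun_approx.
  - by move=> n; apply: measurableT_comp => //; exact: measurable_funTS.
  - by move=> n x _; rewrite lee_fin.
  - by move=> x _ a b ab; rewrite lee_fin//; exact/lefP/nd_nnsfun_approx.
under eq_fun do rewrite nnE.
rewrite -monotone_convergence//=.
- apply: eq_integral => x _; apply/cvg_lim => //.
  by apply: cvgeZr => //; exact: cvg_nnsfun_approx.
- by move=> n; apply: emeasurable_funM => //; exact/measurable_EFinP.
- by move=> n x _; rewrite mule_ge0// lee_fin.
- move=> x _ a b ab; apply: lee_wpmul2r; first by rewrite lee_fin.
  by rewrite lee_fin//; exact/lefP/nd_nnsfun_approx.
Qed.

End density.

(** * Moments of the centred Gaussian law *)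

Section normal_moments.
Context (R : realType) (h : R).
Hypothesis h0 : 0 < h.
Notation mu := (@lebesgue_measure R).
Let p := @normal_pdf R 0 (Num.sqrt h).

Let sh0 : Num.sqrt h != 0.
Proof. by rewrite gt_eqF// sqrtr_gt0. Qed.

Let pE x : p x = normal_peak (Num.sqrt h) * expR (- x ^+ 2 / (h *+ 2)).
Proof.
by rewrite /p normal_pdfE// /normal_fun subr0 sqr_sqrtr// ltW.
Qed.

Let p_ge0 x : 0 <= p x. Proof. exact: normal_pdf_ge0. Qed.

Let pN x : p (- x) = p x. Proof. by rewrite !pE sqrrN. Qed.

Let is_derive_p (x : R) : is_derive x 1 p (- (x / h) * p x).
Proof.
rewrite (_ : p = fun x => normal_peak (Num.sqrt h) * expR (- x ^+ 2 / (h *+ 2)));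
  last by apply/funext => y; exact: pE.
apply: is_derive_eq.
rewrite /GRing.scale/=; field; rewrite gt_eqF//.
Qed.

Let continuous_p : continuous p.
Proof. exact: continuous_normal_pdf. Qed.

(** Primitives obtained by parts from p' = - (x / h) p. Since x^2 p has no elementary primitive,
    [F1] is a primitive of (x^2 - h) p: the variance will come from a comparison with the total
    mass. *)
Let F1 (x : R) : R := - (h * x * p x).
Let F3 (x : R) : R := - ((h * x ^+ 2 + 2 * h ^+ 2) * p x).

Let is_derive_F1 (x : R) : is_derive x 1 F1 ((x ^+ 2 - h) * p x).
Proof.
have dp := is_derive_p x.
by apply: is_derive_eq; rewrite /GRing.scale/=; field; rewrite gt_eqF.
Qed.

Let is_derive_F3 (x : R) : is_derive x 1 F3 (x ^+ 3 * p x).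
Proof.
have dp := is_derive_p x.
by apply: is_derive_eq; rewrite /GRing.scale/=; field; rewrite gt_eqF.
Qed.

Let K := normal_peak (Num.sqrt h) * (8 * h ^+ 2).

Let K_ge0 : 0 <= K.
Proof. by rewrite mulr_ge0// ?normal_peak_ge0// mulr_ge0// sqr_ge0. Qed.

(** From e^y >= y^2 / 2 at y = x^2 / (2h), where y^2 / 2 = x^4 / (8 h^2). The fourth power beats the
    quadratic factor of [F3]. *)
Let p_le x : 0 < x -> p x <= K / x ^+ 4.
Proof.
move=> x0; rewrite pE /K -mulrA ler_wpM2l ?normal_peak_ge0//.
rewrite mulNr expRN ler_pdivlMr ?exprn_gt0//.
rewrite mulrC ler_pdivrMr ?expR_gt0//.
have /(expR_ge1Dxn 1) : 0 <= x ^+ 2 / (h *+ 2).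
  by rewrite divr_ge0 ?sqr_ge0// mulrn_wge0// ltW.
set e := expR _ => le_e.
have -> : x ^+ 4 = 8 * h ^+ 2 * ((x ^+ 2 / (h *+ 2)) ^+ 2 / 2`!%:R).
  by rewrite (_ : 2`!%:R = 2 :> R)//; field; rewrite gt_eqF.
rewrite ler_pM2l ?mulr_gt0 ?exprn_gt0//.
by apply: le_trans le_e; rewrite lerDr.
Qed.

Let cvg0 (F : R -> R) C : 0 <= C ->
  (forall x, 1 <= x -> - (C / x) <= F x <= 0) -> F x @[x --> +oo] --> 0.
Proof.
move=> C0 FC.
apply: (@squeeze_cvgr _ _ _ _ (fun x => - (C / x)) (fun=> 0)).
- near=> x; apply: FC; near: x; exact: nbhs_pinfty_ge.
- rewrite -oppr0 -(mulr0 C); apply: cvgN; apply: cvgMr.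
  apply/gtr0_cvgV0 => //; near=> x; near: x; exact: nbhs_pinfty_gt.
- exact: cvg_cst.
Unshelve. all: by end_near. Qed.

Let cvg_F1 : F1 x @[x --> +oo] --> 0.
Proof.
apply: (@cvg0 _ (h * K)); first by rewrite mulr_ge0// ltW.
move=> x x1; have x0 : 0 < x by apply: lt_le_trans x1.
have hxp : 0 <= h * x * p x by rewrite !mulr_ge0// ltW.
rewrite /F1 lerN2 oppr_le0 hxp andbT -mulrA -[leRHS]mulrA.
rewrite ler_pM2l//; have /(ler_wpM2l (ltW x0)) := p_le x0.
move/le_trans; apply.
rewrite (_ : x * _ = K / x * (x ^+ 2)^-1); last by field; rewrite gt_eqF.
by rewrite ler_piMr ?divr_ge0 ?invf_le1 ?exprn_gt0 ?exprn_ege1// ltW.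
Qed.

Let cvg_F3 : F3 x @[x --> +oo] --> 0.
Proof.
apply: (@cvg0 _ ((h + 2 * h ^+ 2) * K)).
  by rewrite mulr_ge0// addr_ge0 ?ltW// mulr_gt0// exprn_gt0.
move=> x x1; have x0 : 0 < x by apply: lt_le_trans x1.
have h20 : 0 < h ^+ 2 by rewrite exprn_gt0.
have x20 : 0 < x ^+ 2 by rewrite exprn_gt0.
have x21 : 1 <= x ^+ 2 by rewrite exprn_ege1.
have c0 : 0 <= h * x ^+ 2 + 2 * h ^+ 2 by rewrite addr_ge0 ?mulr_ge0 ?ltW.
have c1 : 0 <= (h * x ^+ 2 + 2 * h ^+ 2) * p x by rewrite mulr_ge0.
rewrite /F3 lerN2 oppr_le0 c1 andbT.
have /(ler_wpM2l c0) := p_le x0.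
move/le_trans; apply.
have : (h * x ^+ 2 + 2 * h ^+ 2) * (K / x ^+ 4) <=
       ((h + 2 * h ^+ 2) * x ^+ 2) * (K / x ^+ 4).
  rewrite ler_wpM2r ?divr_ge0 ?exprn_ge0 ?(ltW x0)//.
  by rewrite [in leRHS](mulrDl h) lerD2l ler_peMr// ?mulr_ge0// ltW.
move/le_trans; apply.
rewrite [leLHS](_ : _ = (h + 2 * h ^+ 2) * K / x * x^-1); last first.
  by field; rewrite gt_eqF.
by rewrite ler_piMr ?invf_le1// !mulr_ge0// ?invr_ge0 ?addr_ge0 ?mulr_ge0// ltW.
Qed.

Local Notation N := (normal_prob 0 (Num.sqrt h)).

Let ge0_integral_N (f : R -> R) : measurable_fun setT f ->
  (forall x, 0 <= f x) ->
  (\int[N]_x (f x)%:E = \int[mu]_x (f x * p x)%:E)%E.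
Proof.
move=> mf f0; rewrite (@ge0_integral_density _ _ _ mu N p)//.
- exact: measurable_normal_pdf.
exact/measurable_EFinP.
Qed.

Let setge0 : [set x : R | 0 <= x] = `[0, +oo[%classic.
Proof. by apply/seteqP; split => x /=; rewrite in_itv/= andbT. Qed.

Let continuous_F (F f : R -> R) :
  (forall x : R, is_derive x 1 F (f x)) -> continuous F.
Proof.
by move=> dF x; apply: differentiable_continuous; apply/derivable1_diffP.
Qed.

Let continuous_F1 : continuous F1.
Proof. exact: (@continuous_F F1 _ is_derive_F1). Qed.

Let continuous_F3 : continuous F3.
Proof. exact: (@continuous_F F3 _ is_derive_F3). Qed.

(** By symmetry the moment is twice [- F3 0], that is 4 h^2 p(0), and p(0) <= 1 / sqrt h. What
    matters is the order h^(3/2), which is o(h). *)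
Lemma normal_abs_moment3 :
  (\int[N]_x (`|x| ^+ 3)%:E <= (4 * (h * Num.sqrt h))%:E)%E.
Proof.
have c3 : continuous (fun x : R => x ^+ 3 * p x).
  by move=> x; apply: cvgM; [exact: exprn_continuous|exact: continuous_p].
have cn3 : continuous (fun x : R => `|x| ^+ 3).
  move=> x; apply: (@continuous_comp _ _ _ (fun x : R => `|x|) (fun x => x ^+ 3)).
    exact: norm_continuous.
  exact: exprn_continuous.
rewrite ge0_integral_N//; last exact: continuous_measurable_fun.
rewrite ge0_symfun_integralT; last 3 first.
- by move=> x; rewrite mulr_ge0.
- by move=> x; apply: cvgM; [exact: cn3|exact: continuous_p].
- by move=> x /=; rewrite normrN pN.
rewrite setge0.
have -> : (\int[mu]_(x in `[0%R, +oo[) (`|x| ^+ 3 * p x)%:E =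
    \int[mu]_(x in `[0%R, +oo[) (x ^+ 3 * p x)%:E)%E.
  apply: eq_integral => x; rewrite inE/= in_itv/= andbT => x0.
  by rewrite ger0_norm.
have -> : (\int[mu]_(x in `[0%R, +oo[) (x ^+ 3 * p x)%:E = 0%:E - (F3 0)%:E)%E.
  apply: ge0_continuous_FTC2y.
  - by move=> x x0; rewrite mulr_ge0// exprn_ge0.
  - exact: continuous_subspaceT.
  - exact: cvg_F3.
  - by move=> x _; have [] := is_derive_F3 x.
  - by apply: cvg_at_right_filter; exact: continuous_F3.
  - by move=> x _; rewrite derive1E; have [] := is_derive_F3 x.
rewrite add0e /F3 EFinN oppeK -EFinM lee_fin expr0n/= mulr0 add0r pE.
rewrite expr0n/= oppr0 mul0r expR0 mulr1.
have peak : normal_peak (Num.sqrt h) <= (Num.sqrt h)^-1.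
  rewrite lef_pV2 ?posrE ?sqrtr_gt0 ?mulrn_wgt0 ?mulr_gt0 ?exprn_gt0 ?pi_gt0 ?sqrtr_gt0//.
  rewrite ler_wsqrtr// sqr_sqrtr ?(ltW h0)// -mulrnAr ler_peMr ?(ltW h0)//.
  by have := pi_ge2 R; rewrite mulr2n; lra.
rewrite -subr_ge0 (_ : _ - _ = 4 * (h ^+ 2 * ((Num.sqrt h)^-1 - normal_peak (Num.sqrt h)))).
  by rewrite mulr_ge0// mulr_ge0 ?sqr_ge0// subr_ge0.
rewrite mulrBr mulrBr; congr (_ - _); last by ring.
rewrite -[h in h ^+ 2](sqr_sqrtr (ltW h0)).
set r := Num.sqrt h.
rewrite -[h in LHS](sqr_sqrtr (ltW h0)) -/r; field.
by rewrite gt_eqF// sqrtr_gt0.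
Qed.

Lemma normal_opp (A : set R) : measurable A -> N [set x | A (- x)] = N A.
Proof.
move=> mA; rewrite /normal_prob -/p.
have mp : measurable_fun A (EFin \o p).
  by apply/measurable_EFinP/measurable_funTS; exact: measurable_normal_pdf.
transitivity (\int[mu]_(x in (-%R : R -> measurableTypeR R) @^-1` A)
    ((EFin \o p) \o -%R) x)%E.
  by apply: eq_integral => x _ /=; rewrite pN.
rewrite -ge0_integral_pushforward//=.
- by apply: eq_measure_integral => //= B mB BS; exact: lebesgue_measureN.
- by move=> x _; rewrite lee_fin.
Qed.

Lemma normal_integrable_abs3 : N.-integrable setT (fun x => (`|x| ^+ 3)%:E).
Proof.
apply/integrableP; split.
  apply/measurable_EFinP; apply: (@measurable_funX _ (measurableTypeR R)).
  exact: normr_measurable.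
rewrite (le_lt_trans _ (ltry (4 * (h * Num.sqrt h))))//.
apply: le_trans normal_abs_moment3.
by under eq_integral do rewrite /= ger0_norm ?exprn_ge0//.
Qed.

(** The third absolute moment dominates the lower ones through 1 + |x|^3. *)
Let integrable_N (f : R -> R) : measurable_fun setT f ->
  (forall x, `|f x| <= 1 + `|x| ^+ 3) -> N.-integrable setT (EFin \o f).
Proof.
move=> mf fx.
apply: (@le_integrable _ _ _ N _ measurableT _ (fun x : R => (1 + `|x| ^+ 3)%:E)).
- exact/measurable_EFinP.
- by move=> x _; rewrite /= lee_fin (ger0_norm (x := 1 + _))// addr_ge0// exprn_ge0.
- rewrite (_ : (fun _ => _) = (cst 1%:E \+ (fun x : R => (`|x| ^+ 3)%:E)))//.
  apply: integrableD => //; last exact: normal_integrable_abs3.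
  exact: finite_measure_integrable_cst.
Qed.

Lemma normal_integrable_id : N.-integrable setT (fun x => x%:E).
Proof.
apply: integrable_N => // x.
have := normr_ge0 x; set y := `|x| => y0; have [y1|/ltW y1] := leP y 1.
  by rewrite (le_trans y1)// lerDl exprn_ge0.
by rewrite (@le_trans _ _ (y ^+ 3))// ?ler_eXnr// lerDr.
Qed.

Lemma normal_integrable_sqr : N.-integrable setT (fun x => (x ^+ 2)%:E).
Proof.
apply: integrable_N => // x; rewrite normrX.
have := normr_ge0 x; set y := `|x| => y0; have [y1|/ltW y1] := leP y 1.
  by rewrite (@le_trans _ _ 1)// ?exprn_ile1// lerDl exprn_ge0.
by rewrite (@le_trans _ _ (y ^+ 3))// ?ler_weXn2l// lerDr.
Qed.

(** By symmetry the mean equals its opposite; being finite, it is zero. *)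
Lemma normal_mean : (\int[N]_x x%:E = 0)%E.
Proof.
have NE : (\int[N]_x x%:E = \int[N]_x (- x)%:E)%E.
  transitivity (\int[pushforward N (-%R : measurableTypeR R -> measurableTypeR R)]_x x%:E)%E.
    by apply: eq_measure_integral => A mA _; exact/esym/normal_opp.
  rewrite integral_pushforward//= preimage_setT.
  exact: (integrableN normal_integrable_id).
have fN : (\int[N]_x x%:E)%E \is a fin_num.
  by apply: integrable_fin_num => //; exact: normal_integrable_id.
have : (\int[N]_x (- x)%:E = - \int[N]_x x%:E)%E.
  under eq_integral do rewrite -mulN1r EFinM.
  by rewrite integralZl//; [rewrite EFinN mulN1e|exact: normal_integrable_id].
rewrite -NE -(fineK fN) -EFinN => -[] /eqP.
by rewrite -subr_eq0 opprK -mulr2n mulrn_eq0/= => /eqP ->.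
Qed.

Lemma normal_variance : (\int[N]_x (x ^+ 2)%:E = h%:E)%E.
Proof.
have mp : measurable_fun setT p by exact: measurable_normal_pdf.
have c2 : continuous (fun x : R => x ^+ 2 * p x).
  by move=> x; apply: cvgM; [exact: exprn_continuous|exact: continuous_p].
have Ip : (\int[mu]_x (p x)%:E = 1)%E by exact: integral_normal_pdf.
have I2 : (\int[mu]_x (x ^+ 2 * p x)%:E < +oo)%E.
  rewrite -(ge0_integral_N (f := fun x => x ^+ 2)).
  + have /integrableP[_] := normal_integrable_sqr.
    by under eq_integral do rewrite /= ger0_norm ?sqr_ge0//.
  + exact: measurable_funX.
  + by move=> x; exact: sqr_ge0.
rewrite ge0_integral_N; last 2 first.
  exact: measurable_funX.
  by move=> x; exact: sqr_ge0.
pose f (x : R) := (x ^+ 2 - h) * p x.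
have cf : continuous f.
  move=> x; apply: cvgM; last exact: continuous_p.
  by apply: cvgB; [exact: exprn_continuous|exact: cvg_cst].
(* [f] changes sign at [a], and the improper fundamental theorem of calculus asks for a nonnegative
   integrand, so it is applied on [[a, +oo[] only. The boundary terms at [a] cancel, and [F1]
   vanishes at 0 and at infinity. *)
pose a := Num.sqrt h.
have a0 : 0 < a by rewrite sqrtr_gt0.
have E1 : (\int[mu]_(x in `[0%R, a]) (f x)%:E = (F1 a)%:E - (F1 0)%:E)%E.
  apply: continuous_FTC2 => //.
  - exact: continuous_subspaceT.
  - split.
    + by move=> x _; have [] := is_derive_F1 x.
    + by apply: cvg_at_right_filter; exact: continuous_F1.
    + by apply: cvg_at_left_filter; exact: continuous_F1.
  - by move=> x _; rewrite derive1E; have [] := is_derive_F1 x.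
have E2 : (\int[mu]_(x in `[a, +oo[) (f x)%:E = 0%:E - (F1 a)%:E)%E.
  apply: ge0_continuous_FTC2y.
  - move=> x ax; rewrite mulr_ge0// subr_ge0 -(sqr_sqrtr (ltW h0)).
    by rewrite ler_sqr// ?nnegrE ?(ltW a0)// (le_trans (ltW a0)).
  - exact: continuous_subspaceT.
  - exact: cvg_F1.
  - by move=> x _; have [] := is_derive_F1 x.
  - by apply: cvg_at_right_filter; exact: continuous_F1.
  - by move=> x _; rewrite derive1E; have [] := is_derive_F1 x.
have E : (\int[mu]_(x in `[0%R, +oo[) (f x)%:E = 0)%E.
  have mf : measurable_fun setT f by exact: continuous_measurable_fun.
  rewrite (@itv_bndbnd_setU _ _ _ (BRight a))//; last by rewrite bnd_simp ltW.
  rewrite integral_setU//=; last 2 first.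
    exact/measurable_EFinP/measurable_funTS.
    apply/disj_setPLR => x/=; rewrite !in_itv/= andbT => /andP[_ xa].
    by apply/negP; rewrite -leNgt.
  rewrite E1 integral_itv_obnd_cbnd; last exact/measurable_EFinP/measurable_funTS.
  by rewrite E2 /F1 mulr0 mul0r oppr0 sube0 add0e subee.
have i2 : mu.-integrable `[0, +oo[ (fun x => (x ^+ 2 * p x)%:E).
  apply: (@integrableS _ _ _ _ setT) => //.
  apply/integrableP; split.
    by apply/measurable_EFinP; exact: continuous_measurable_fun.
  rewrite [X in (X < _)%E](_ : _ = \int[mu]_x (x ^+ 2 * p x)%:E)%E//.
  by apply: eq_integral => x _; rewrite abse_EFin ger0_norm// mulr_ge0// sqr_ge0.
have ip : mu.-integrable `[0, +oo[ (fun x => (p x)%:E).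
  apply: (@integrableS _ _ _ _ setT) => //.
  exact: integrable_normal_pdf.
have E3 : (\int[mu]_(x in `[0%R, +oo[) (x ^+ 2 * p x)%:E =
    h%:E * \int[mu]_(x in `[0%R, +oo[) (p x)%:E)%E.
  rewrite -integralZl//.
  have ihp : mu.-integrable `[0, +oo[ (fun x => (h%:E * (p x)%:E)%E).
    exact: integrableZl.
  have := integrable_fin_num _ i2; have := integrable_fin_num _ ihp.
  move=> /(_ _)/fineK <-// /(_ _)/fineK <-//.
  have := E; rewrite (_ : (\int[mu]_(x in `[0%R, +oo[) (f x)%:E)%E =
    (\int[mu]_(x in `[0%R, +oo[) ((x ^+ 2 * p x)%:E - h%:E * (p x)%:E))%E); last first.
    by apply: eq_integral => x _; rewrite -EFinM -EFinB -mulrBl.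
  rewrite integralB//.
  have := integrable_fin_num _ i2; have := integrable_fin_num _ ihp.
  move=> /(_ _)/fineK <-// /(_ _)/fineK <-//.
  by rewrite -EFinB => -[] /eqP; rewrite subr_eq0 => /eqP ->.
rewrite ge0_symfun_integralT; last 3 first.
- by move=> x; rewrite mulr_ge0// sqr_ge0.
- exact: c2.
- by move=> x /=; rewrite sqrrN pN.
rewrite setge0 E3 muleCA.
rewrite -[RHS]mule1 -Ip ge0_symfun_integralT ?setge0// => x /=.
by rewrite pN.
Qed.

End normal_moments.

(** * Gaussian laws and the heat semigroup *)

(* Locked: otherwise conversion tests between [heat s] and [heat t] unfold the
   normal law. *)
HB.lock Definition heat (R : realType) (t : R) : set (measurableTypeR R) -> \bar R :=
  if t == 0 then \d_(0 : measurableTypeR R) else normal_prob 0 (Num.sqrt t).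
Canonical heat_unlockable := Unlockable heat.unlock.

Section heat_probability.
Context (R : realType) (t : R).

Let heat_set0 : heat t set0 = 0%E.
Proof. by rewrite unlock; case: ifP => _; rewrite measure0. Qed.

Let heat_ge0 A : (0 <= heat t A)%E.
Proof. by rewrite unlock; case: ifP => _; exact: measure_ge0. Qed.

Let heat_sigma_additive : semi_sigma_additive (heat t).
Proof. by rewrite unlock; case: ifP => _; exact: measure_semi_sigma_additive. Qed.

HB.instance Definition _ := isMeasure.Build _ _ _ (heat t)
  heat_set0 heat_ge0 heat_sigma_additive.

Let heat_setT : heat t setT = 1%E.
Proof. by rewrite unlock; case: ifP => _; exact: probability_setT. Qed.

HB.instance Definition _ := Measure_isProbability.Build _ _ _ (heat t) heat_setT.

End heat_probability.

(** * Taylor expansion and the generator of the heat semigroup *)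

Section taylor.
Context (R : realType).

(** The derivative is bounded only up to distance [|y|] from 0, so [C] may depend on [y]; this
    allows the lemma to be iterated. *)
Lemma mvt_bound (g dg : R -> R) (C y : R) :
  (forall z : R, is_derive z 1 g (dg z)) -> g 0 = 0 ->
  (forall z, `|z| <= `|y| -> `|dg z| <= C) -> `|g y| <= C * `|y|.
Proof.
move=> dgP g0 Cdg.
have cg : continuous g.
  by move=> x; apply: differentiable_continuous; apply/derivable1_diffP.
have [y0|y0] := leP 0 y.
  have [|c] := @MVT_segment R g dg _ _ y0 (fun x _ => dgP x).
    exact: continuous_subspaceT.
  rewrite in_itv/= => /andP[c0 cy]; rewrite g0 !subr0 => ->.
  rewrite normrM ler_wpM2r// Cdg// !ger0_norm//.
have [|c] := @MVT_segment R g dg _ _ (ltW y0) (fun x _ => dgP x).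
  exact: continuous_subspaceT.
rewrite in_itv/= => /andP[c0 cy]; rewrite g0 !sub0r => /(congr1 (@Num.norm _ _)).
rewrite normrN normrM normrN => ->; rewrite ler_wpM2r// Cdg//.
by rewrite !ler0_norm ?lerN2// ltW.
Qed.

Variables (f0 f1 f2 f3 : R -> R) (M : R).
Hypothesis df0 : forall x : R, is_derive x 1 f0 (f1 x).
Hypothesis df1 : forall x : R, is_derive x 1 f1 (f2 x).
Hypothesis df2 : forall x : R, is_derive x 1 f2 (f3 x).
Hypothesis f3M : forall x, `|f3 x| <= M.

Let derive_shift (f df : R -> R) (x : R) :
  (forall x : R, is_derive x 1 f (df x)) ->
  forall y : R, is_derive y 1 (fun y => f (x + y)) (df (x + y)).
Proof.
move=> dfP y; have dx : is_derive y 1 (fun y : R => x + y) 1.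
  have dx : is_derive y 1 (cst x + (id : R -> R)) (0 + 1) by exact: is_deriveD.
  by rewrite add0r in dx.
by rewrite -[df _]mulr1; exact: is_derive1_comp.
Qed.

(** The remainders [r0], [r1], [r2] vanish at 0 and each is a primitive of the next, so three uses
    of [mvt_bound] suffice. The iteration yields the constant [M] in place of M / 6. *)
Lemma taylor2_bound x y :
  `|f0 (x + y) - f0 x - y * f1 x - y ^+ 2 / 2 * f2 x| <= M * `|y| ^+ 3.
Proof.
have M0 : 0 <= M by apply: le_trans (f3M 0).
pose r2 y := f2 (x + y) - f2 x.
have d2 (z : R) : is_derive z 1 r2 (f3 (x + z)).
  have := derive_shift x df2 z => d.
  by rewrite -[f3 _]subr0; apply: is_deriveB.
have b2 z : `|r2 z| <= M * `|z|.
  by apply: (mvt_bound d2) => [|w _]; [rewrite /r2 addr0 subrr|exact: f3M].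
pose r1 y := f1 (x + y) - f1 x - y * f2 x.
have d1 (z : R) : is_derive z 1 r1 (r2 z).
  have := derive_shift x df1 z => d.
  by apply: is_derive_eq; rewrite /GRing.scale/= /r2; ring.
have b1 z : `|r1 z| <= M * `|z| * `|z|.
  apply: (mvt_bound d1) => [|w wz]; first by rewrite /r1 addr0 mul0r subr0 subrr.
  by rewrite (le_trans (b2 w))// ler_wpM2l.
pose r0 y := f0 (x + y) - f0 x - y * f1 x - y ^+ 2 / 2 * f2 x.
have d0 (z : R) : is_derive z 1 r0 (r1 z).
  have := derive_shift x df0 z => d.
  by apply: is_derive_eq; rewrite /GRing.scale/= /r1; field.
rewrite [`|y| ^+ 3]exprSr expr2 !mulrA; apply: (mvt_bound d0).
  by rewrite /r0 addr0 mul0r expr0n/= !mul0r !subr0 subrr.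
move=> w wz; rewrite (le_trans (b1 w))//.
by rewrite ler_pM// ?mulr_ge0// ler_wpM2l.
Qed.

End taylor.

Section heat_expectation.
Context (R : realType).
Implicit Types (f : R -> R) (t h : R).

Lemma heat_integrable t f M : measurable_fun setT f ->
  (forall x, `|f x| <= M) -> (heat t).-integrable setT (EFin \o f).
Proof.
move=> mf fM; apply: measurable_bounded_integrable => //.
  by rewrite /= probability_setT ltry.
exists M; split=> [|x Mx y _ /=]; first exact: num_real.
by rewrite (le_trans (fM y))// ltW.
Qed.

Lemma heat_cst t c : \int[heat t]_x c = c.
Proof. by rewrite Rintegral_cst//= probability_setT mulr1. Qed.

Lemma heat_bound t f M : measurable_fun setT f ->
  (forall x, `|f x| <= M) -> `|\int[heat t]_x f x| <= M.
Proof.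
move=> mf fM; have fi := heat_integrable t mf fM.
rewrite (le_trans (le_normr_Rintegral _ fi))// -[leRHS](heat_cst t).
apply: le_Rintegral => //.
- exact: integrable_norm.
- exact: finite_measure_integrable_cst.
Qed.

Lemma heat0 f : measurable_fun setT f -> \int[heat 0]_x f x = f 0.
Proof.
move=> mf; rewrite /Rintegral.
rewrite (eq_measure_integral \d_(0 : measurableTypeR R)); last first.
  by move=> A mA _ /=; rewrite unlock eqxx.
rewrite integral_dirac//; last exact/measurable_EFinP.
by rewrite diracT mul1e.
Qed.

Variables (f0 f1 f2 f3 : R -> R) (M0 M1 M2 M : R).
Hypothesis df0 : forall x : R, is_derive x 1 f0 (f1 x).
Hypothesis df1 : forall x : R, is_derive x 1 f1 (f2 x).
Hypothesis df2 : forall x : R, is_derive x 1 f2 (f3 x).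
Hypothesis f0M : forall x : R, `|f0 x| <= M0.
Hypothesis f2M : forall x, `|f2 x| <= M2.
Hypothesis f3M : forall x, `|f3 x| <= M.

Let cf (f df : R -> R) :
  (forall x : R, is_derive x 1 f (df x)) -> measurable_fun setT f.
Proof.
move=> dfP; apply: continuous_measurable_fun => x.
by apply: differentiable_continuous; apply/derivable1_diffP.
Qed.

(** After integration of the Taylor expansion, the mean kills the linear term, the variance gives
    the factor h / 2, and the third absolute moment bounds the remainder uniformly in [x]. *)
Lemma heat_taylor h x : 0 < h ->
  `|\int[heat h]_y f0 (x + y) - f0 x - h / 2 * f2 x| <= 4 * M * (h * Num.sqrt h).
Proof.
move=> h0.
have mf0 := cf df0.
have mfx : measurable_fun setT (fun y => f0 (x + y)).
  by apply: measurableT_comp => //; exact: measurable_funD.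
have ifx := heat_integrable h mfx (fun y => f0M (x + y)).
have heatE : heat h = normal_prob 0 (Num.sqrt h) by rewrite unlock gt_eqF.
have intE (f : R -> \bar R) :
    (\int[heat h]_y f y = \int[normal_prob 0 (Num.sqrt h)]_y f y)%E.
  by apply: eq_measure_integral => A _ _ /=; rewrite heatE.
have i1 : (heat h).-integrable setT (EFin \o (fun y => y : R)).
  by rewrite heatE; exact: normal_integrable_id.
have i2 : (heat h).-integrable setT (EFin \o (fun y : R => y ^+ 2)).
  by rewrite heatE; exact: normal_integrable_sqr.
have i3 : (heat h).-integrable setT (EFin \o (fun y : R => `|y| ^+ 3)).
  by rewrite heatE; exact: normal_integrable_abs3.
have M0' : 0 <= M by apply: le_trans (f3M 0).
have ic c : (heat h).-integrable setT (EFin \o cst c).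
  exact: finite_measure_integrable_cst.
pose r y := f0 (x + y) - f0 x - y * f1 x - y ^+ 2 / 2 * f2 x.
have ia : (heat h).-integrable setT (EFin \o (fun y => f0 (x + y) - f0 x)).
  exact: (integrableB _ ifx (ic (f0 x))).
have ib : (heat h).-integrable setT (EFin \o (fun y => y * f1 x)).
  exact: (integrableZr _ _ i1).
have id : (heat h).-integrable setT (EFin \o (fun y => y ^+ 2 * (2^-1 * f2 x))).
  exact: (integrableZr _ _ i2).
have iab : (heat h).-integrable setT (EFin \o (fun y => f0 (x + y) - f0 x - y * f1 x)).
  exact: (integrableB _ ia ib).
have ir : (heat h).-integrable setT (EFin \o (fun y => f0 (x + y) - f0 x - y * f1 x - y ^+ 2 * (2^-1 * f2 x))).
  exact: (integrableB _ iab id).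
have rE : \int[heat h]_y (f0 (x + y) - f0 x - y * f1 x - y ^+ 2 * (2^-1 * f2 x)) = \int[heat h]_y f0 (x + y) - f0 x - h / 2 * f2 x.
  rewrite RintegralB// RintegralB// RintegralB//; last exact: ic.
  rewrite heat_cst.
  rewrite RintegralZr// RintegralZr//.
  have -> : \int[heat h]_y y = 0.
    by rewrite /Rintegral intE normal_mean.
  have -> : \int[heat h]_y (y ^+ 2) = h.
    by rewrite /Rintegral intE normal_variance.
  by rewrite mul0r subr0 mulrA.
rewrite -rE (le_trans (le_normr_Rintegral _ ir))//.
apply: (@le_trans _ _ (\int[heat h]_y (M * `|y| ^+ 3))).
  apply: le_Rintegral => //.
  - exact: integrable_norm.
  - exact: (integrableZl _ _ i3).
  - move=> y _; rewrite mulrA.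
    exact: (taylor2_bound df0 df1 df2 f3M).
rewrite RintegralZl// [leRHS]mulrAC [leRHS]mulrC ler_wpM2l//.
rewrite -lee_fin /Rintegral fineK ?integrable_fin_num// intE.
exact: normal_abs_moment3.
Qed.

(** The semigroup law is kept as a hypothesis here: its proof relies on the existence of a Brownian
    motion. *)
Hypothesis heatD : forall (s t : R) (f : R -> R) (C : R), 0 <= s -> 0 <= t ->
  measurable_fun setT f -> (forall x, `|f x| <= C) ->
  \int[heat (s + t)]_x f x = \int[heat s]_x (\int[heat t]_y f (x + y)).

(** The semigroup law reduces the increment to an average of [heat_taylor] over the starting point,
    where the bound is uniform. *)
Lemma heat_increment t h : 0 <= t -> 0 < h ->
  `|\int[heat (t + h)]_x f0 x - \int[heat t]_x f0 x
    - h / 2 * \int[heat t]_x f2 x| <= 4 * M * (h * Num.sqrt h).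
Proof.
move=> t0 h0; have mf0 := cf df0; have mf2 := cf df2.
have if0 := heat_integrable t mf0 f0M.
have if2 := heat_integrable t mf2 f2M.
pose g x := \int[heat h]_y f0 (x + y).
have mg : measurable_fun setT g.
  pose F (z : measurableTypeR R * measurableTypeR R) := f0 (z.1 + z.2).
  have mF : measurable_fun setT F.
    by apply: measurableT_comp => //; apply: measurable_funD.
  have iF : (heat t \x heat h)%E.-integrable setT (EFin \o F).
    apply: measurable_bounded_integrable => //.
      by rewrite /= -setXTT product_measure1E//= !probability_setT mule1 ltry.
    exists M0; split=> [|x Mx y _ /=]; first exact: num_real.
    by rewrite (le_trans (f0M _))// ltW.
  apply: measurableT_comp => //; exact: (measurable_fubini_F iF).
have gM x : `|g x| <= M0.
  by apply: heat_bound => //; apply: measurableT_comp => //; exact: measurable_funD.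
have ig := heat_integrable t mg gM.
have -> : \int[heat (t + h)]_x f0 x - \int[heat t]_x f0 x - h / 2 * \int[heat t]_x f2 x =
    \int[heat t]_x (g x - f0 x - h / 2 * f2 x).
  rewrite RintegralB//; last 2 first.
  - exact: (integrableB _ ig if0).
  - exact: (integrableZl _ _ if2).
  rewrite RintegralB// RintegralZl//; congr (_ - _ - _).
  exact: (heatD t0 (ltW h0) mf0 f0M).
apply: heat_bound; last by move=> x; exact: heat_taylor.
by apply: measurable_funB; [exact: measurable_funB|exact: measurable_funM].
Qed.

End heat_expectation.

Section increments.
Context (R : realType).

Lemma cvg_sqrt_bound (G : R -> R) (l C : R) (A : set_system R) : Filter A ->
  0 <= C -> A `=>` 0^' ->
  (\forall h \near A, `|h| <= 1 -> `|G h - l| <= C * Num.sqrt `|h|) ->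
  G @ A --> l.
Proof.
move=> FA C0 A0 GC; apply/cvgrPdist_le => /= e e0.
(* [C] may be zero, hence the division by [C + 1]. *)
have C1 : 0 < C + 1 by rewrite ltr_wpDl.
have eC : 0 < e / (C + 1) by rewrite divr_gt0.
have d0 : 0 < (e / (C + 1)) ^+ 2 by rewrite exprn_gt0.
have small : \forall h \near A, `|h| <= (e / (C + 1)) ^+ 2 /\ `|h| <= 1.
  apply: A0; near=> h; split.
    by near: h; apply: dnbhs0_le.
  by near: h; apply: dnbhs0_le.
apply: filterS2 GC small => h Gh [h1 h2].
rewrite distrC (le_trans (Gh h2))//.
have : Num.sqrt `|h| <= e / (C + 1).
  by rewrite -[leRHS](ger0_norm (ltW eC)) -[leRHS]sqrtr_sqr ler_wsqrtr.
rewrite ler_pdivlMr// => /(le_trans _) => le_e.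
by rewrite le_e// mulrC ler_wpM2l ?sqrtr_ge0// lerDl.
Unshelve. all: by end_near. Qed.

Variables (F G : R -> R) (C : R).
Hypothesis C0 : 0 <= C.
Hypothesis FG : forall s h, 0 <= s -> 0 < h ->
  `|F (s + h) - F s - h / 2 * G s| <= C * (h * Num.sqrt h).
Hypothesis GC : forall s h, 0 <= s -> 0 < h -> h <= 1 ->
  `|G (s + h) - G s| <= C * Num.sqrt h.

(* The base point [s] of the increments in [FG] is arbitrary, so that [FG] at
   [s = t - k] also controls the left difference quotients at [t]. *)
Lemma is_derive_increments (t : R) : 0 < t -> is_derive t 1 F (2^-1 * G t).
Proof.
move=> t0.
have cv : (fun h => h^-1 *: (F (h *: 1 + t) - F t)) @ 0^' --> 2^-1 * G t.
  apply: (@cvg_sqrt_bound _ _ (C + C)) => //; first by rewrite addr_ge0.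
  near=> h => h1.
  have h0 : h != 0 by near: h; exact: nbhs_dnbhs_neq.
  have ht : `|h| <= t by near: h; apply: dnbhs0_le.
  rewrite /GRing.scale/= mulr1.
  have [hp|hn] := ltrP 0 h.
    have := FG (ltW t0) hp; rewrite (gtr0_norm hp) [h + t]addrC => H.
    have -> : h^-1 * (F (t + h) - F t) - 2^-1 * G t =
        h^-1 * (F (t + h) - F t - h / 2 * G t) by field.
    rewrite normrM gtr0_norm ?invr_gt0// ler_pdivrMl//.
    rewrite (le_trans H)// mulrCA ler_pM2l// ler_wpM2r ?sqrtr_ge0//.
    by rewrite lerDl.
  have {}hn : h < 0 by rewrite lt_neqAle h0.
  have [k hk] : exists k, h = - k by exists (- h); rewrite opprK.
  have k0 : 0 < k by rewrite -oppr_lt0 -hk.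
  have kE : `|h| = k by rewrite hk normrN gtr0_norm.
  rewrite kE in ht h1 *.
  have tk : 0 <= t - k by rewrite subr_ge0.
  have := FG tk k0; have := GC tk k0 h1; rewrite subrK => H2 H.
  rewrite hk [- k + t]addrC.
  (* The expansion at [t - k] has slope [G (t - k)]; [GC] controls the replacement of this slope by
     [G t], which accounts for the second [C] in the constant. *)
  have -> : (- k)^-1 * (F (t - k) - F t) - 2^-1 * G t =
     k^-1 * (F t - F (t - k) - k / 2 * G (t - k)) - 2^-1 * (G t - G (t - k)).
    by field; rewrite gt_eqF.
  rewrite (le_trans (ler_normB _ _))// mulrDl lerD//.
    rewrite normrM gtr0_norm ?invr_gt0// ler_pdivrMl//.
    by rewrite (le_trans H)// mulrCA.
  rewrite normrM ger0_norm//.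
  have := normr_ge0 (G t - G (t - k)); lra.
apply: DeriveDef; last exact: cvg_lim cv.
by apply/cvg_ex; exists (2^-1 * G t).
Unshelve. all: by end_near. Qed.

End increments.

Section heat_flow.
Context (R : realType).
Hypothesis heatD : forall (s t : R) (f : R -> R) (C : R), 0 <= s -> 0 <= t ->
  measurable_fun setT f -> (forall x, `|f x| <= C) ->
  \int[heat (s + t)]_x f x = \int[heat s]_x (\int[heat t]_y f (x + y)).

Variables (f : nat -> R -> R) (M : nat -> R).
Hypothesis df : forall k (x : R), is_derive x 1 (f k) (f k.+1 x).
Hypothesis fM : forall k (x : R), `|f k x| <= M k.

Let mf k : measurable_fun setT (f k).
Proof.
apply: continuous_measurable_fun => x.
by apply: differentiable_continuous; apply/derivable1_diffP; have [] := df k x.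
Qed.

Let M_ge0 k : 0 <= M k. Proof. exact: le_trans (fM k 0). Qed.

Let incr k (t h : R) : 0 <= t -> 0 < h ->
  `|\int[heat (t + h)]_x f k x - \int[heat t]_x f k x
    - h / 2 * \int[heat t]_x f k.+2 x| <= 4 * M k.+3 * (h * Num.sqrt h).
Proof.
move=> t0 h0.
by apply: (@heat_increment R (f k) (f k.+1) (f k.+2) (f k.+3) (M k) (M k.+2)).
Qed.

(** The increment is of order h; it is weakened to sqrt h, the modulus in which [cvg_sqrt_bound] and
    [is_derive_increments] are phrased. *)
Let lip k (t h : R) : 0 <= t -> 0 < h -> h <= 1 ->
  `|\int[heat (t + h)]_x f k x - \int[heat t]_x f k x|
    <= (M k.+2 + 4 * M k.+3) * Num.sqrt h.
Proof.
move=> t0 h0 h1.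
have hE : h = Num.sqrt h * Num.sqrt h by rewrite -expr2 sqr_sqrtr// ltW.
have hs : h <= Num.sqrt h.
  by rewrite [leLHS]hE ler_piMl ?sqrtr_ge0// -sqrtr1 ler_wsqrtr.
have F2 : `|\int[heat t]_x f k.+2 x| <= M k.+2 by apply: heat_bound.
have := incr k t0 h0; move: F2.
move: (\int[heat (t + h)]_x f k x) (\int[heat t]_x f k x) (\int[heat t]_x f k.+2 x).
move=> a b c cM H; have -> : a - b = (a - b - h / 2 * c) + h / 2 * c.
  by rewrite subrK.
rewrite (le_trans (ler_normD _ _))// addrC mulrDl lerD//.
  rewrite normrM ger0_norm ?divr_ge0 ?(ltW h0)// [leRHS]mulrC ler_pM//.
    by rewrite divr_ge0 ?(ltW h0).
  by lra.
rewrite (le_trans H)// ler_wpM2l ?mulr_ge0//.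
by rewrite ler_piMl ?sqrtr_ge0.
Qed.

Lemma heat_flow_derive (t : R) : 0 < t ->
  is_derive t 1 (fun s => \int[heat s]_x f 0 x) (2^-1 * \int[heat t]_x f 2 x).
Proof.
(* One constant for both hypotheses: [incr] at order 0 costs [4 * M 3], and [lip] at order 2 costs
   [M 4 + 4 * M 5]. *)
apply: (@is_derive_increments _ _ (fun s => \int[heat s]_x f 2 x)
  (4 * M 3 + (M 4 + 4 * M 5))).
- by rewrite !addr_ge0 ?mulr_ge0.
- move=> s h s0 h0; rewrite (le_trans (incr 0 s0 h0))// ler_wpM2r//.
    by rewrite mulr_ge0 ?sqrtr_ge0 ?ltW.
  by rewrite lerDl addr_ge0 ?mulr_ge0.
- move=> s h s0 h0 h1; rewrite (le_trans (lip 2 s0 h0 h1))// ler_wpM2r ?sqrtr_ge0//.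
  by rewrite lerDr mulr_ge0.
Qed.

Lemma heat_flow_cvg0 : \int[heat t]_x f 0 x @[t --> 0^'+] --> f 0 0.
Proof.
(* The limit is the value of the flow at time zero, [heat 0] being a Dirac mass, so that [lip] with
   base point 0 applies. *)
rewrite -(heat0 (mf 0)).
apply: (@cvg_sqrt_bound _ _ _ (M 2 + 4 * M 3)).
- by rewrite addr_ge0// mulr_ge0.
- move=> A; rewrite /at_right /dnbhs /within/=; apply: filterS => x Ax x0.
  by apply: Ax; rewrite gt_eqF.
- near=> h => h1; have h0 : 0 < h by near: h; exact: nbhs_right_gt.
  rewrite (gtr0_norm h0) in h1 *.
  by have := @lip 0 0 h (lexx 0) h0 h1; rewrite add0r.
Unshelve. all: by end_near. Qed.

End heat_flow.

(** * Bounds for the derivatives of test functions *)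

Section test_functions.
Context (R : realType) (phi : R -> R).
Hypothesis phiT : test_function phi.

Lemma test_function_derive k (x : R) :
  is_derive x 1 (derive1n k phi) (derive1n k.+1 phi x).
Proof.
rewrite derive1nS derive1E; apply: DeriveDef => //; exact: phiT.1.
Qed.

Lemma test_function_continuous k : continuous (derive1n k phi).
Proof.
move=> x; apply: differentiable_continuous; apply/derivable1_diffP.
exact: phiT.1.
Qed.

(** The complement of the closed support is open, so vanishing there passes to the derivative, which
    is local. *)
Lemma test_function_supp k x :
  ~ closure [set x | phi x != 0] x -> derive1n k phi x = 0.
Proof.
elim: k x => [|k IH] x xphi.
  apply/eqP/negPn/negP => px; apply: xphi; exact: subset_closure.
rewrite derive1nS derive1E -(derive_cst (0 : R) x 1).
apply: near_eq_derive.
have : open (~` closure [set x | phi x != 0]).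
  by apply: closed_openC; exact: closed_closure.
rewrite openE => /(_ x xphi); apply: filterS => y; exact: IH.
Qed.

Lemma test_function_bounded k : exists M, forall x, `|derive1n k phi x| <= M.
Proof.
have cK := phiT.2; set K := closure _ in cK.
have /compact_bounded[M [_ HM]] : compact (derive1n k phi @` K).
  apply: continuous_compact => //; apply: continuous_subspaceT.
  exact: test_function_continuous.
exists (`|M| + 1) => x; have [xK|xK] := pselect (K x).
  apply: HM; last by exists x.
  by rewrite (le_lt_trans (ler_norm M))// ltrDl.
by rewrite test_function_supp// normr0 addr_ge0.
Qed.

End test_functions.

(** * Brownian motions and independence *)

(* [mu] need not be a probability; [c] is the weight that remains after
   restricting to an independent event. *)
Lemma pushforward_product d d1 d2 (T : measurableType d) (T1 : measurableType d1)
    (T2 : measurableType d2) (R : realType) (mu : {measure set T -> \bar R})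
    (m1 : {sigma_finite_measure set T1 -> \bar R})
    (m2 : {sigma_finite_measure set T2 -> \bar R}) (V : T -> T1 * T2) (c : R) :
  0 <= c -> measurable_fun setT V ->
  (forall A B, measurable A -> measurable B ->
    mu (V @^-1` (A `*` B)) = (c%:E * (m1 A * m2 B))%E) ->
  forall X, measurable X -> mu (V @^-1` X) = (c%:E * (m1 \x m2) X)%E.
Proof.
move=> c0 mV muV X mX.
have mVX Y : measurable Y -> measurable (V @^-1` Y).
  by move=> mY; rewrite -[X in measurable X]setTI; exact: mV.
(* Uniqueness of the product measure is applied to [mu] rescaled by [c^-1]; for [c = 0] the whole
   space is [mu]-null. *)
have [c00|cn0] := eqVneq c 0.
  rewrite c00 mul0e; apply: (@subset_measure0 _ _ _ mu _ (V @^-1` (setT `*` setT))).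
  - exact: mVX.
  - by apply: mVX; apply: measurableX.
  - by move=> x.
  - by have := muV _ _ measurableT measurableT; rewrite c00 mul0e.
have ci0 : 0 <= c^-1 by rewrite invr_ge0.
pose m' := measure_function_pushforward__canonical__measure_function_Measure
  (mscale (NngNum ci0) mu) mV.
rewrite (@product_measure_unique _ _ _ _ _ m1 m2 m')//.
  by rewrite /m'/= /pushforward /mscale/= muleA -EFinM divff// mul1e.
move=> A B mA mB; rewrite /m'/= /pushforward /mscale/= muV//.
by rewrite muleA -EFinM mulVf// mul1e.
Qed.

Section brownian_law.
Context d (Omega : measurableType d) (R : realType) (P : probability Omega R).
Implicit Types W : R -> Omega -> R.

Lemma ae_eq_law (X Y : Omega -> R) (A : set R) : measurable_fun setT X ->
  measurable_fun setT Y -> {ae P, forall w, X w = Y w} -> measurable A ->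
  P (X @^-1` A) = P (Y @^-1` A).
Proof.
move=> mX mY XY mA.
have mXA : measurable (X @^-1` A) by rewrite -[X in measurable X]setTI; exact: mX.
have mYA : measurable (Y @^-1` A) by rewrite -[X in measurable X]setTI; exact: mY.
rewrite -(setIT (X @^-1` A)) -(setIT (Y @^-1` A)) -!integral_indic//.
apply: ge0_ae_eq_integral => //.
- by apply/measurable_EFinP.
- by apply/measurable_EFinP.
- apply: filterS XY => w XYw _; rewrite !indicE; congr (_%:R%:E).
  by congr (nat_of_bool _); apply/idP/idP; rewrite !inE /= XYw.
Qed.

Section one_motion.
Variable W : R -> Omega -> R.
Hypothesis bmW : standard_brownian_motion P W.

(** The degenerate case [s = t] is what the Dirac mass in [heat] is for; rounded lifetimes may well
    be zero. *)
Lemma bm_increment_law (s t : R) (A : set R) : 0 <= s -> s <= t -> measurable A ->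
  P [set w | A (W t w - W s w)] = heat (t - s) A.
Proof.
move=> s0; rewrite le_eqVlt => /predU1P[<-|st] mA; last first.
  by rewrite (bm_gaussian bmW)// unlock gt_eqF// subr_gt0.
rewrite unlock subrr eqxx diracE.
rewrite (_ : [set w | _] = if 0 \in A then setT else set0).
  by case: ifP => _; rewrite ?probability_setT// measure0.
apply/seteqP; split => w /=; rewrite subrr; first by move=> A0; rewrite mem_set.
by case: ifPn => //; rewrite inE.
Qed.

(** The motion starts at 0 almost surely only, so [W t] is compared with the increment from time
    0. *)
Lemma bm_law (t : R) (A : set R) : 0 <= t -> measurable A ->
  P (W t @^-1` A) = heat t A.
Proof.
move=> t0 mA.
rewrite -[in RHS](subr0 t) -(bm_increment_law (lexx 0) t0 mA).
apply: (@ae_eq_law _ (W t \- W 0)) => //.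
- exact: bm_measurable bmW _ t0.
- by apply: measurable_funB; apply: bm_measurable bmW _ _.
- by apply: filterS (bm_start bmW) => w /= ->; rewrite subr0.
Qed.

(** The increments of [W] over [0, s] and [s, s + t] are independent, and their sum is the increment
    over [0, s + t]. *)
Lemma heat_conv (s t : R) (B : set R) : 0 <= s -> 0 <= t -> measurable B ->
  (heat s \x heat t)%E [set z | B (z.1 + z.2)] = heat (s + t) B.
Proof.
move=> s0 t0 mB.
pose V w : measurableTypeR R * measurableTypeR R :=
  (W s w - W 0 w, W (s + t) w - W s w).
have st : s <= s + t by rewrite lerDl.
have mW r : 0 <= r -> measurable_fun setT (W r) by exact: bm_measurable bmW r.
have mV : measurable_fun setT V.
  apply/measurable_fun_pair; apply: measurable_funB; apply: mW => //.
  exact: addr_ge0.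
(* The times 0, s, s + t, after which the default value of [nth] keeps the sequence constant; only
   the first two increments are used. *)
pose sq := nth (s + t) [:: 0; s].
have nsq : nondecreasing_seq sq.
  apply/nondecreasing_seqP => -[|[|[|k]]] //=.
have mD : measurable [set z : measurableTypeR R * measurableTypeR R | B (z.1 + z.2)].
  have : measurable_fun setT (fun z : measurableTypeR R * measurableTypeR R => z.1 + z.2).
    by apply: measurable_funD.
  by move/(_ measurableT _ mB); rewrite setTI.
rewrite -[LHS]mul1e -(@pushforward_product _ _ _ _ _ _ _ P _ _ V)//; last first.
  move=> A C mA mC.
  have := @bm_indep_increments _ _ _ _ _ bmW sq (lexx 0) nsq [:: 0; 1]%N
    (fun k => if k == 0%N then [set w | A (W s w - W 0 w)]
              else [set w | C (W (s + t) w - W s w)]).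
  rewrite mul1e !big_cons big_nil/= mule1 !bm_increment_law// subr0 addrAC subrr add0r => <-//.
    congr (P _); apply/seteqP; split.
      by move=> w [/= wA wC] k /=; rewrite !inE => /orP[]/eqP ->.
    move=> w H; split; first exact: (H 0%N).
    by apply: (H 1%N); rewrite /= !inE.
  move=> k; rewrite !inE => /orP[]/eqP -> /=.
    by exists A => //; rewrite setTI.
  by exists C => //; rewrite setTI.
rewrite -[in RHS](subr0 (s + t)) -bm_increment_law ?addr_ge0//.
have VE w : W s w - W 0 w + (W (s + t) w - W s w) = W (s + t) w - W 0 w by ring.
by congr (P _); apply/seteqP; split => w /=; rewrite VE.
Qed.

(** [heat_conv] identifies [heat (s + t)] with the image of the product under addition; Fubini
    applies because [f] is bounded. *)
Lemma heatD (s t : R) (f : R -> R) (C : R) : 0 <= s -> 0 <= t ->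
  measurable_fun setT f -> (forall x, `|f x| <= C) ->
  \int[heat (s + t)]_x f x = \int[heat s]_x (\int[heat t]_y f (x + y)).
Proof.
move=> s0 t0 mf fC.
pose add (z : measurableTypeR R * measurableTypeR R) : measurableTypeR R := z.1 + z.2.
have madd : measurable_fun setT add by exact: measurable_funD.
have mF : measurable_fun setT (f \o add) by exact: measurableT_comp.
have iF : (heat s \x heat t)%E.-integrable setT (EFin \o (f \o add)).
  apply: measurable_bounded_integrable => //.
    by rewrite /= -setXTT product_measure1E//= !probability_setT mule1 ltry.
  exists C; split=> [|x Cx y _ /=]; first exact: num_real.
  by rewrite (le_trans (fC _))// ltW.
rewrite /Rintegral; congr fine.
transitivity (\int[pushforward (heat s \x heat t)%E add]_x (f x)%:E)%E.
  by apply: eq_measure_integral => A mA _; exact/esym/heat_conv.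
rewrite integral_pushforward//; last exact/measurable_EFinP.
rewrite preimage_setT -(integral12_prod_meas1 iF).
apply: eq_integral => x _; rewrite fineK//.
apply: integrable_fin_num => //; apply: (heat_integrable t _ (M := C)) => //.
by apply: measurableT_comp => //; exact: measurable_funD.
Qed.

End one_motion.
End brownian_law.

Section independence.
Context d (Omega : measurableType d) (R : realType) (P : probability Omega R).
Context (I : choiceType) (Z : I -> Omega -> R).
Hypothesis mZ : forall i, measurable_fun setT (Z i).
Hypothesis indepZ : mutually_independent P (fun i => sigma_rv (Z i)).

(** Cylinder events: for fixed [s], those with measurable sides are a pi-system generating the
    sigma-algebra of the [Z i] with [i] in [s]. *)
Definition rectangle (s : seq I) (B : I -> set R) : set Omega :=
  \bigcap_(i in [set` s]) Z i @^-1` B i.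

Lemma rectangle_cons i s B :
  rectangle (i :: s) B = Z i @^-1` B i `&` rectangle s B.
Proof. by rewrite /rectangle !bigcap_seq big_cons. Qed.

Lemma measurable_rectangle s B : (forall i, measurable (B i)) ->
  measurable (rectangle s B).
Proof.
move=> mB; apply: fin_bigcap_measurable => // i _.
by rewrite -[X in measurable X]setTI; exact: mZ.
Qed.

Lemma rectangle_prob s B : uniq s -> (forall i, measurable (B i)) ->
  P (rectangle s B) = (\prod_(i <- s) P (Z i @^-1` B i))%E.
Proof.
move=> us mB; apply: indepZ => // i _.
by exists (B i); rewrite ?setTI.
Qed.

(** Independence is known on rectangles, and a condition on a sum is not one. By induction on [L],
    the condition on [Z i] is absorbed into the rectangle, hence the arbitrary [s]; this gives the
    joint law of [Z i] and the remaining sum, to which the convolution law applies. *)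
Lemma rectangle_sum_law (a : I -> R) (L : seq I) :
  (forall (s t : R) (B : set R), 0 <= s -> 0 <= t -> measurable B ->
    (heat s \x heat t)%E [set z | B (z.1 + z.2)] = heat (s + t) B) ->
  (forall i, i \in L -> 0 <= a i) ->
  (forall i A, i \in L -> measurable A -> P (Z i @^-1` A) = heat (a i) A) ->
  forall s B C, uniq (L ++ s) -> (forall i, measurable (B i)) -> measurable C ->
  P (rectangle s B `&` [set w | C (\sum_(i <- L) Z i w)]) =
  (P (rectangle s B) * heat (\sum_(i <- L) a i) C)%E.
Proof.
move=> hconv; elim: L => [|i L IH] a0 lawZ s B C /=.
  move=> _ mB mC; rewrite big_nil heat.unlock eqxx diracE.
  rewrite (_ : [set w | _] = if 0 \in C then setT else set0); last first.
    apply/seteqP; split => w /=; rewrite big_nil; first by move=> C0; rewrite mem_set.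
    by case: ifPn => //; rewrite inE.
  by case: ifP => _; rewrite ?setIT ?mule1// setI0 measure0 mule0.
rewrite mem_cat negb_or => /andP[/andP[iL is_] uLs] mB mC.
pose F := rectangle s B.
have mF : measurable F by exact: measurable_rectangle.
pose S w := \sum_(j <- L) Z j w.
have mS : measurable_fun setT S by exact: measurable_sum.
pose a' := \sum_(j <- L) a j.
have a'0 : 0 <= a' by rewrite /a' big_seq sumr_ge0// => j jL; rewrite a0// inE jL orbT.
have ai0 : 0 <= a i by rewrite a0// mem_head.
pose V w : measurableTypeR R * measurableTypeR R := (Z i w, S w).
have mV : measurable_fun setT V.
  by apply/measurable_fun_pair; [exact: mZ|exact: mS].
have rectE A D : measurable A -> measurable D ->
    P (V @^-1` (A `*` D) `&` F) = (P F * (heat (a i) A * heat a' D))%E.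
  move=> mA mD.
  (* As [i] is not in [s], imposing [A] at [i] leaves [rectangle s B] unchanged. *)
  pose B' j : set R := if j == i then A else B j.
  have mB' j : measurable (B' j).
    by rewrite /B'; case: ifP => _; [exact: mA|exact: mB].
  have FE : rectangle s B' = F.
    rewrite /F /rectangle; apply: eq_bigcapr => j /= js.
    by rewrite /B' (negbTE (_ : j != i))//; apply: contraNneq is_ => <-.
  have us : uniq s by move: uLs; rewrite cat_uniq => /and3P[].
  have FiE : rectangle (i :: s) B' = Z i @^-1` A `&` F.
    by rewrite rectangle_cons FE /B' eqxx.
  have PFi : P (rectangle (i :: s) B') = (heat (a i) A * P F)%E.
    rewrite rectangle_prob//=; last by rewrite is_.
    rewrite big_cons -rectangle_prob// FE /B' eqxx lawZ// mem_head//.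
  have H : P (rectangle (i :: s) B' `&` [set w | D (S w)]) =
      (P (rectangle (i :: s) B') * heat a' D)%E.
    apply: IH => //.
    - by move=> j jL; apply: a0; rewrite inE jL orbT.
    - by move=> j A' jL; apply: lawZ; rewrite inE jL orbT.
    - by rewrite (perm_uniq (permEl (perm_catCA L [:: i] s)))/= mem_cat negb_or iL is_.
  rewrite muleA (muleC (P F)) -PFi -H FiE; congr (P _).
  by apply/seteqP; split => w /= [[]].
rewrite (_ : _ `&` _ = V @^-1` [set z | C (z.1 + z.2)] `&` F); last first.
  by rewrite setIC; apply/seteqP; split => w /=; rewrite big_cons.
rewrite big_cons -hconv//.
have PFE : P F = (fine (P F))%:E by rewrite fineK// fin_num_measure.
rewrite PFE.
(* Restricted to [F], the pair [V] has the product law with weight [P F]. *)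
apply: (@pushforward_product _ _ _ _ _ _ _ (mrestr P mF) (heat (a i)) (heat a') V (fine (P F))) => //.
- by rewrite fine_ge0.
- by move=> A D mA mD; rewrite -PFE; exact: rectE.
- have : measurable_fun setT (fun z : measurableTypeR R * measurableTypeR R => z.1 + z.2).
    by apply: measurable_funD.
  by move/(_ measurableT _ mC); rewrite setTI.
Qed.

(** Both sides are finite measures in [A] that agree on a pi-system. *)
Lemma g_rectangle_indep (s : seq I) (E : set Omega) :
  measurable E ->
  (forall B, (forall i, measurable (B i)) ->
    P (rectangle s B `&` E) = (P (rectangle s B) * P E)%E) ->
  forall A, <<s [set rectangle s B | B in [set B | forall i, measurable (B i)]] >> A ->
  P (A `&` E) = (P A * P E)%E.
Proof.
move=> mE H A sA.
set G := [set rectangle s B | B in _] in sA.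
have cge0 : 0 <= fine (P E) by rewrite fine_ge0.
pose m1 := mrestr P mE.
pose m2 := mscale (NngNum cge0) P.
have GT : G setT.
  exists (fun=> setT); first by move=> i; exact: measurableT.
  by apply/seteqP; split.
have -> : P (A `&` E) = m1 A by [].
have -> : (P A * P E)%E = m2 A.
  by rewrite /m2 /mscale/= fineK ?fin_num_measure// muleC.
apply: (g_sigma_algebra_measure_unique G _ (fun=> setT)) => //.
- by move=> _ [B mB <-]; exact: measurable_rectangle.
- by rewrite bigcup_const//; exists 0%N.
- move=> _ _ [B mB <-] [C mC <-]; exists (fun i => B i `&` C i).
    by move=> i; apply: measurableI; [exact: mB|exact: mC].
  by rewrite /rectangle -bigcapI.
- move=> _ [B mB <-]; rewrite /= /mrestr /mscale/= H//.
  by rewrite fineK ?fin_num_measure// muleC.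
- by move=> k; rewrite /= /mrestr setTI ltey_eq fin_num_measure.
Qed.

End independence.

(** The last hypothesis says that, under [P] restricted to [A], the image law of [Y] is [nu] with
    weight [P A]. *)
Lemma ge0_integral_indep d (Omega : measurableType d) (R : realType)
    (P : probability Omega R) (A : set Omega) (Y : Omega -> measurableTypeR R)
    (nu : probability (measurableTypeR R) R) (g : R -> R) :
  measurable A -> measurable_fun setT Y -> measurable_fun setT g ->
  (forall x, 0 <= g x) ->
  (forall C, measurable C -> P (A `&` Y @^-1` C) = P A * nu C)%E ->
  (\int[P]_w (g (Y w) * \1_A w)%:E = P A * \int[nu]_x (g x)%:E)%E.
Proof.
move=> mA mY mg g0 AY.
have mgY : measurable_fun setT (g \o Y) by exact: measurableT_comp.
have PA0 : 0 <= fine (P A) by rewrite fine_ge0.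
transitivity (\int[mrestr P mA]_w ((g \o Y) w)%:E)%E.
  rewrite (@ge0_integral_density _ _ _ P (mrestr P mA) (\1_A))//.
  - by move=> B mB; rewrite integral_indic// /= /mrestr setIC.
  - exact/measurable_EFinP.
  - by move=> x; rewrite lee_fin; exact: g0.
transitivity (\int[pushforward (mrestr P mA) Y]_x (g x)%:E)%E.
  rewrite ge0_integral_pushforward//; first exact/measurable_EFinP.
  by move=> x _; rewrite lee_fin.
rewrite -[P A]fineK ?fin_num_measure//.
rewrite -(@ge0_integral_mscale _ _ _ nu setT measurableT (NngNum PA0))//.
- apply: eq_measure_integral => C mC _.
  rewrite /= /pushforward /mrestr /mscale/= fineK ?fin_num_measure//.
  by rewrite -AY// setIC.
- exact/measurable_EFinP.
- by move=> x _; rewrite lee_fin.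
Qed.

(** * Events determined by the lifetimes along a line of descent *)

Section lifetimes.
Context (R : realType).
Implicit Types (u : seq bool).

(** The word [u] itself is included, unlike in [birth_time]. *)
Definition ancestors u := [seq take k u | k <- iota 0 (size u).+1].

Lemma size_ancestor u k : (k <= size u)%N -> size (take k u) = k.
Proof. by move=> ku; rewrite size_take_min; apply/minn_idPl. Qed.

Lemma uniq_ancestors u : uniq (ancestors u).
Proof.
rewrite map_inj_in_uniq ?iota_uniq// => i j; rewrite !mem_iota/= !add0n !ltnS.
by move=> iu ju /(congr1 size); rewrite !size_ancestor.
Qed.

Lemma mem_ancestors u k : (k <= size u)%N -> take k u \in ancestors u.
Proof. by move=> ku; apply/mapP; exists k => //; rewrite mem_iota/= add0n ltnS. Qed.

(* The exponential law only makes lifetimes nonnegative almost surely. *)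
Definition lifetimes_ge0 (Omega : Type) (tau : seq bool -> Omega -> R) u :=
  [set w | forall k : 'I_(size u).+1, 0 <= tau (take k u) w].

Section measurability.
Context d (T : measurableType d) (tau : seq bool -> T -> R) (u : seq bool).
Hypothesis mtau : forall k, (k <= size u)%N -> measurable_fun setT (tau (take k u)).

(** The measurable space [T] is arbitrary because these facts are needed twice: on [Omega], and for
    the smaller sigma-algebra generated by the lifetimes alone. *)
Lemma measurable_birth_time : measurable_fun setT (birth_time tau u).
Proof. by apply: measurable_sum => k; apply: mtau; exact: ltnW. Qed.

Lemma measurable_alive (t : R) : measurable [set w | alive tau t w u].
Proof.
have mb := measurable_birth_time.
have mu : measurable_fun setT (tau u) by have := mtau (leqnn _); rewrite take_size.
have mbu : measurable_fun setT (fun w => birth_time tau u w + tau u w).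
  exact: measurable_funD.
have h : measurable_fun setT (fun w => (birth_time tau u w <= t) && (t < birth_time tau u w + tau u w)).
  apply: measurable_and.
    exact: measurable_fun_ler.
  exact: measurable_fun_ltr.
have := h measurableT [set true] I; rewrite setTI.
by congr (measurable _); apply/seteqP; split.
Qed.

Lemma measurable_lifetimes_ge0 : measurable (lifetimes_ge0 tau u).
Proof.
rewrite (_ : lifetimes_ge0 _ _ =
    \bigcap_(k in [set: 'I_(size u).+1]) [set w | 0 <= tau (take k u) w]).
  apply: fin_bigcap_measurable => // k _.
  have := measurable_fun_le measurableT (@measurable_cst _ _ T R setT 0) (mtau (leq_ord k)).
  by rewrite setTI.
by apply/seteqP; split => w /= H k; first move=> _; apply: H.
Qed.

Lemma measurable_digits (q : R) n (dg : 'I_n -> nat) : (n <= size u)%N ->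
  measurable [set w | forall k : 'I_n,
    (dg k)%:R <= q * tau (take k u) w < (dg k).+1%:R].
Proof.
move=> nu.
rewrite (_ : [set w | _] = \bigcap_(k in [set: 'I_n])
    [set w | (dg k)%:R <= q * tau (take k u) w < (dg k).+1%:R]).
  apply: fin_bigcap_measurable => // k _.
  have ku : (k <= size u)%N by rewrite (leq_trans (ltnW (ltn_ord k))).
  have mq : measurable_fun setT (fun w => q * tau (take k u) w).
    by apply: measurable_funM => //; exact: mtau.
  have h : measurable_fun setT (fun w => ((dg k)%:R <= q * tau (take k u) w) &&
      (q * tau (take k u) w < (dg k).+1%:R)).
    apply: measurable_and.
      exact: measurable_fun_ler.
    exact: measurable_fun_ltr.
  have := h measurableT [set true] I; rewrite setTI.
  by congr (measurable _); apply/seteqP; split.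
by apply/seteqP; split => w /= H k; first move=> _; apply: H.
Qed.

End measurability.
End lifetimes.

Section branching.
Context d (Omega : measurableType d) (R : realType) (P : probability Omega R).
Variables (tau : seq bool -> Omega -> R) (W : seq bool -> R -> Omega -> R).
Hypothesis bbm : binary_branching_bm P tau W.

(** * The law of one particle *)

(* The motions are first sampled at deterministic durations [sch]: by the
   independence of lifetimes and motions the event that the lifetimes fall in
   given cells does not interfere with the law of the displacement. *)
Section schedule.
Variable sch : nat -> R.
Hypothesis sch0 : forall k, 0 <= sch k.

(** The duration may depend on the generation alone, since a line of descent meets each generation
    once. *)
Definition scheduled (i : seq bool + seq bool) : Omega -> R :=
  match i with inl v => tau v | inr v => W v (sch (size v)) end.

Lemma measurable_scheduled i : measurable_fun setT (scheduled i).
Proof.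
case: i => v /=; first exact: bbm_lifetime_measurable bbm v.
exact: bm_measurable (bbm_motion bbm v) _ (sch0 _).
Qed.

Lemma scheduled_indep : mutually_independent P (fun i => sigma_rv (scheduled i)).
Proof.
move=> s E us HE; apply: (bbm_independent bbm us) => i /HE.
case: i => v //= Ev; apply: sub_sigma_algebra; by exists (sch (size v)) => //=; exact: sch0.
Qed.

Let lifetimes (u : seq bool) : seq (seq bool + seq bool) := map inl (ancestors u).
Let G u := [set rectangle scheduled (lifetimes u) B | B in
  [set B : _ -> set R | forall i, measurable (B i)]].

Lemma lifetime_g_measurable u k : (k <= size u)%N ->
  measurable_fun setT (tau (take k u) : g_sigma_algebraType (G u) -> R).
Proof.
move=> ku _ Y mY; rewrite setTI; apply: sub_sigma_algebra.
exists (fun i => if i == inl (take k u) then Y else setT).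
  by move=> i; case: ifP.
apply/seteqP; split => w /= H.
  have := H (inl (take k u)); rewrite eqxx; apply => /=.
  by rewrite mem_map ?mem_ancestors// => ? ? [].
by move=> i _; case: eqP => [->//|].
Qed.

(** [rectangle_sum_law] treats cylinder events of the lifetimes, and [g_rectangle_indep] extends the
    result to every event that they generate. *)
Lemma scheduled_sum_law u (A : set (g_sigma_algebraType (G u))) (C : set R) :
  measurable A -> measurable C ->
  P (A `&` [set w | C (\sum_(k < (size u).+1) W (take k u) (sch k) w)]) =
  (P A * heat (\sum_(k < (size u).+1) sch k) C)%E.
Proof.
move=> mA mC.
pose L : seq (seq bool + seq bool) := map inr (ancestors u).
pose a (i : seq bool + seq bool) := match i with inl v => 0 | inr v => sch (size v) end.
have sumE (F : seq bool + seq bool -> R) :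
    \sum_(i <- L) F i = \sum_(k < (size u).+1) F (inr (take k u)).
  rewrite /L big_map /ancestors big_map.
  by rewrite -(big_mkord xpredT (fun k => F (inr (take k u)))) /index_iota subn0.
pose E := [set w | C (\sum_(i <- L) scheduled i w)].
have mE : measurable E.
  have : measurable_fun setT (fun w => \sum_(i <- L) scheduled i w).
    by apply: measurable_sum => i; exact: measurable_scheduled.
  by move/(_ measurableT _ mC); rewrite setTI.
have bm0 := bbm_motion bbm [::].
have uLs : uniq (L ++ lifetimes u).
  have uinj (F : seq bool -> seq bool + seq bool) :
      injective F -> uniq (map F (ancestors u)).
    by move=> Finj; rewrite (map_inj_uniq Finj) uniq_ancestors.
  rewrite cat_uniq; apply/and3P; split.
  - by apply: (uinj inr) => ? ? [].
  - by apply/hasPn => _ /mapP[v _ ->]; apply/negP => /mapP[].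
  - by apply: (uinj inl) => ? ? [].
have H B : (forall i, measurable (B i)) ->
    P (rectangle scheduled (lifetimes u) B `&` E) =
    (P (rectangle scheduled (lifetimes u) B) * heat (\sum_(i <- L) a i) C)%E.
  move=> mB; apply: rectangle_sum_law => //.
  - exact: measurable_scheduled.
  - exact: scheduled_indep.
  - exact: heat_conv bm0.
  - by move=> i _; case: i => v //=; exact: sch0.
  - move=> [v|v] A' vL mA'; first by case/mapP: vL.
    by apply: (bm_law (bbm_motion bbm v)) => //; exact: sch0.
(* The trivial rectangle gives the law of the sum itself. *)
have PE : P E = heat (\sum_(i <- L) a i) C.
  have := H (fun=> setT) (fun=> measurableT).
  rewrite (_ : rectangle _ _ _ = setT); last by apply/seteqP; split.
  by rewrite setTI probability_setT mul1e.
have aE : \sum_(i <- L) a i = \sum_(k < (size u).+1) sch k.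
  rewrite sumE; apply: eq_bigr => k _ /=; rewrite size_ancestor//; exact: leq_ord.
have EE : E = [set w | C (\sum_(k < (size u).+1) W (take k u) (sch k) w)].
  apply/funext => w; rewrite /E/= sumE; congr (C _).
  by apply: eq_bigr => k _ /=; rewrite size_ancestor//; exact: leq_ord.
rewrite -EE -aE -PE; apply: (g_rectangle_indep measurable_scheduled mE _ mA).
by move=> B mB; rewrite H// PE.
Qed.

End schedule.

Section word.
Variables (u : seq bool) (t M : R) (g : R -> R).
Hypothesis t0 : 0 <= t.
Hypothesis cg : continuous g.
Hypothesis g0 : forall x, 0 <= g x.
Hypothesis gM : forall x, g x <= M.

Let n := size u.
Let A := [set w | alive tau t w u] `&` lifetimes_ge0 tau u.

Let mtau (v : seq bool) : measurable_fun setT (tau v).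
Proof. exact: bbm_lifetime_measurable bbm v. Qed.

Let mA : measurable A.
Proof.
by apply: measurableI;
  [exact: measurable_alive|exact: measurable_lifetimes_ge0].
Qed.

Let mg : measurable_fun setT g.
Proof. exact: continuous_measurable_fun. Qed.

(* Rounding each lifetime of an ancestor down to a multiple of [1 / q], and
   granting the last motion the time that is left, keeps the total duration
   equal to [t] and leaves finitely many schedules to consider. *)
Section mesh.
Variable m : nat.
Let q : R := m.+1%:R.
(** On [A] the lifetime of a strict ancestor is at most the birth time, hence at most [t], so its
    digit is below [N]. *)
Let N := (Num.truncn (q * t)).+1.

Let q0 : 0 < q. Proof. by rewrite ltr0n. Qed.

Let digit (k : nat) (w : Omega) : nat := Num.truncn (q * tau (take k u) w).

Let cell (j : {ffun 'I_n -> 'I_N}) : set Omega := A `&` [set w | forall k : 'I_n,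
  (j k)%:R <= q * tau (take k u) w < (j k).+1%:R].

(** [insub] fails for all [k >= n], of which only [k = n], the last motion, occurs in a path. *)
Let sched (j : {ffun 'I_n -> 'I_N}) (k : nat) : R :=
  if insub k is Some i then (j i)%:R / q else t - \sum_(i < n) (j i)%:R / q.

Let path_sum (j : {ffun 'I_n -> 'I_N}) (w : Omega) : R :=
  \sum_(k < n.+1) W (take k u) (sched j k) w.

Definition approx_position (w : Omega) : R :=
  \sum_(k < n) W (take k u) ((digit k w)%:R / q) w
  + W u (t - \sum_(k < n) (digit k w)%:R / q) w.

Let sched_ord (j : {ffun 'I_n -> 'I_N}) (k : 'I_n) : sched j k = (j k)%:R / q.
Proof. by rewrite /sched valK. Qed.

Let sched_last (j : {ffun 'I_n -> 'I_N}) :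
  sched j n = t - \sum_(i < n) (j i)%:R / q.
Proof. by rewrite /sched insubN// ltnn. Qed.

Let sched_sum (j : {ffun 'I_n -> 'I_N}) : \sum_(k < n.+1) sched j k = t.
Proof.
rewrite big_ord_recr/= sched_last.
by under eq_bigr do rewrite sched_ord; rewrite addrC subrK.
Qed.

Let cell_digit j w : cell j w -> forall k : 'I_n, digit k w = j k.
Proof. by move=> [_ H] k; exact: truncn_def. Qed.

Let tau_ge0 w k : A w -> (k <= n)%N -> 0 <= tau (take k u) w.
Proof. by move=> [_ Aw]; rewrite -ltnS => kn; exact: (Aw (Ordinal kn)). Qed.

Let digit_le w k : A w -> (k <= n)%N -> (digit k w)%:R / q <= tau (take k u) w.
Proof.
move=> Aw kn; rewrite ler_pdivrMr// mulrC truncn_le.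
by rewrite mulr_ge0 ?(ltW q0)// tau_ge0.
Qed.

Lemma digit_sum_le w : A w -> \sum_(k < n) (digit k w)%:R / q <= t.
Proof.
move=> Aw; have [/andP[+ _] _] := Aw; apply: le_trans.
by apply: ler_sum => k _; apply: digit_le => //; exact: ltnW.
Qed.

(** A point of the cell is required: the remaining time is nonnegative because [u] is born before
    [t] there and digits round down. *)
Let sched_ge0 j w : cell j w -> forall k, 0 <= sched j k.
Proof.
move=> cw k; rewrite /sched; case: insubP => [i _ _|_].
  by rewrite divr_ge0// ltW.
rewrite subr_ge0; under eq_bigr do rewrite -(cell_digit cw).
by apply: digit_sum_le; case: cw.
Qed.

Let path_sum_cell j w : cell j w -> path_sum j w = approx_position w.
Proof.
move=> cw; rewrite /path_sum /approx_position big_ord_recr/= take_size sched_last.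
congr (_ + W u (t - _) w); apply: eq_bigr => k _; rewrite (cell_digit cw)//.
by rewrite sched_ord.
Qed.

Let jof w : {ffun 'I_n -> 'I_N} := [ffun k : 'I_n => inord (digit k w)].

Let cell_jof w : A w -> cell (jof w) w.
Proof.
move=> Aw; split=> // k; have kn : (k <= n)%N by exact: ltnW.
have q_tau : 0 <= q * tau (take k u) w by rewrite mulr_ge0 ?(ltW q0)// tau_ge0.
have dN : (digit k w < N)%N.
  rewrite ltnS truncn_ge_nat; last by rewrite mulr_ge0 ?(ltW q0).
  have [/andP[bt _] _] := Aw.
  apply: (@le_trans _ _ (q * tau (take k u) w)); first by rewrite truncn_le.
  rewrite ler_pM2l// (le_trans _ bt)// /birth_time (bigD1 k)//= lerDl.
  by apply: sumr_ge0 => i _; apply: tau_ge0 => //; exact: ltnW.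
by rewrite ffunE inordK// -truncn_eq.
Qed.

Let cell_uniq j w : cell j w -> j = jof w.
Proof.
move=> cw; apply/ffunP => k; rewrite ffunE (cell_digit cw); apply/val_inj.
by rewrite /= inordK// ltn_ord.
Qed.

(** The cells partition [A], with [jof w] the index of the cell of [w]. *)
Let sum_cells (F : {ffun 'I_n -> 'I_N} -> R) w :
  \sum_j F j * \1_(cell j) w = \1_A w * F (jof w).
Proof.
have [wA|wA] := pselect (A w); last first.
  rewrite [\1_A w]indicE memNset// mul0r big1// => j _.
  by rewrite indicE memNset ?mulr0// => -[].
rewrite (bigD1 (jof w))//= big1 ?addr0.
  by rewrite !indicE !mem_set ?mul1r ?mulr1//; exact: cell_jof.
move=> j; rewrite indicE; have [/set_mem/cell_uniq ->|] := boolP (w \in cell j).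
  by rewrite eqxx.
by rewrite mulr0.
Qed.

Let mcell j : measurable (cell j).
Proof. by apply: measurableI => //; exact: measurable_digits. Qed.

Let cell_integral j :
  (\int[P]_w (g (path_sum j w) * \1_(cell j) w)%:E =
   P (cell j) * \int[heat t]_x (g x)%:E)%E.
Proof.
(* The schedule of an empty cell may end with a negative duration, where nothing is known of the
   motion; such a cell contributes zero. *)
have [->|/set0P[w0 cw0]] := eqVneq (cell j) set0.
  rewrite measure0 mul0e; apply: integral0_eq => w _.
  by rewrite indicE in_set0 mulr0.
have s0 := sched_ge0 cw0.
have mY : measurable_fun setT (path_sum j).
  apply: measurable_sum => k; exact: bm_measurable (bbm_motion bbm _) _ (s0 _).
apply: ge0_integral_indep => // C mC.
(* The durations sum to [t] whatever [j] is, so all cells share the law [heat t]. The cell is then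
   shown to be an event of the lifetimes alone. *)
rewrite -(sched_sum j); apply: (scheduled_sum_law s0) => //.
have mt k : (k <= size u)%N -> measurable_fun setT (tau (take k u) : g_sigma_algebraType _ -> R) :=
  @lifetime_g_measurable (sched j) u k.
apply: measurableI; last exact: (measurable_digits mt).
by apply: measurableI; [exact: (measurable_alive mt)|exact: (measurable_lifetimes_ge0 mt)].
Qed.

Let cell_measurable j :
  measurable_fun setT (fun w => g (path_sum j w) * \1_(cell j) w).
Proof.
have [->|/set0P[w0 cw0]] := eqVneq (cell j) set0.
  by rewrite (_ : (fun _ => _) = cst 0)//; apply/funext => w; rewrite indicE in_set0 mulr0.
apply: measurable_funM; last exact: measurable_indic.
apply: measurableT_comp => //; apply: measurable_sum => k.
exact: bm_measurable (bbm_motion bbm _) _ (sched_ge0 cw0 _).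
Qed.

Let approxE w :
  g (approx_position w) * \1_A w = \sum_j g (path_sum j w) * \1_(cell j) w.
Proof.
rewrite (sum_cells (fun j => g (path_sum j w))) mulrC.
have [wA|wA] := pselect (A w); first by rewrite path_sum_cell//; exact: cell_jof.
by rewrite indicE memNset// !mul0r.
Qed.

Lemma approx_measurable : measurable_fun setT (fun w => g (approx_position w) * \1_A w).
Proof.
rewrite (_ : (fun _ => _) = fun w => \sum_j g (path_sum j w) * \1_(cell j) w).
  by apply: measurable_sum => j; exact: cell_measurable.
by apply/funext => w; exact: approxE.
Qed.

Let sum_cell_prob : (\sum_j P (cell j) = P A)%E.
Proof.
transitivity (\int[P]_w (\sum_j 1 * \1_(cell j) w)%:E)%E.
  under [RHS]eq_integral do rewrite -sumEFin.
  rewrite ge0_integral_sum//=.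
  - by apply: eq_bigr => j _; under eq_integral do rewrite mul1r; rewrite integral_indic// setIT.
  - by move=> j; apply/measurable_EFinP; apply: measurable_funM => //; exact: measurable_indic.
under eq_integral do rewrite (sum_cells (fun=> 1)) mulr1.
by rewrite integral_indic// setIT.
Qed.

(** The right-hand side does not depend on the mesh [m], so the limit has to be taken on the left
    only. *)
Lemma approx_integral :
  (\int[P]_w (g (approx_position w) * \1_A w)%:E = P A * \int[heat t]_x (g x)%:E)%E.
Proof.
under eq_integral do rewrite approxE -sumEFin.
rewrite ge0_integral_sum//=.
- rewrite -sum_cell_prob ge0_sume_distrl//.
  by apply: eq_bigr => j _; exact: cell_integral.
- by move=> j; apply/measurable_EFinP; exact: cell_measurable.
- by move=> j w _; rewrite lee_fin mulr_ge0.
Qed.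

Lemma approx_time w k : A w -> (k <= n)%N ->
  `|tau (take k u) w - (digit k w)%:R / q| <= q^-1.
Proof.
move=> Aw kn; rewrite ger0_norm ?subr_ge0 ?digit_le//.
rewrite -(ler_pM2l q0) mulrBr mulfV ?gt_eqF// mulrCA mulfV ?gt_eqF// mulr1.
by rewrite lerBlDl natr1 ltW// truncnS_gt.
Qed.

End mesh.

(** Paths are continuous within [[0, +oo[] only, hence the sign conditions. *)
Let cvg_motion v w (s : nat -> R) (l : R) : (forall m, 0 <= s m) -> 0 <= l ->
  s @ \oo --> l -> W v (s m) w @[m --> \oo] --> W v l w.
Proof.
move=> s0 l0 sl.
have /subspace_continuousP/(_ l) := @bm_continuous _ _ _ _ _ (bbm_motion bbm v) w.
rewrite /= in_itv/= l0 => /(_ isT); apply: cvg_comp.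
move=> U Ul; have sU : \forall m \near \oo, s m \in `[0, +oo[ -> U (s m).
  exact: sl _ Ul.
change (\forall m \near \oo, U (s m)); apply: filterS sU => m.
by apply; rewrite in_itv/= s0.
Qed.

Let cvg_digit w k : A w -> (k <= n)%N ->
  (Num.truncn (m.+1%:R * tau (take k u) w))%:R / m.+1%:R @[m --> \oo]
    --> tau (take k u) w.
Proof.
move=> Aw kn; apply/cvgrPdist_le => e e0.
have /cvgrPdist_le/(_ e e0) := @cvg_harmonic R; apply: filterS => m /=.
by rewrite sub0r normrN ger0_norm// => /(le_trans _); apply; exact: approx_time.
Qed.

Let cvg_approx w : A w ->
  approx_position m w @[m --> \oo] --> particle_position tau W u t w.
Proof.
move=> Aw.
apply: cvgD.
  apply: cvg_big => [|k _]; first exact: add_continuous.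
  apply: cvg_motion; last by apply: cvg_digit => //; exact: ltnW.
  - by move=> m; rewrite divr_ge0.
  - by case: Aw => _ /(_ (widen_ord (leqnSn n) k)).
have [/andP[bt _] _] := Aw.
apply: cvg_motion.
- by move=> m; rewrite subr_ge0; exact: digit_sum_le.
- by rewrite subr_ge0.
apply: cvgB; first exact: cvg_cst.
apply: cvg_big => [|k _]; first exact: add_continuous.
by apply: cvg_digit => //; exact: ltnW.
Qed.

Let cvg_word w : g (approx_position m w) * \1_A w @[m --> \oo] -->
  g (particle_position tau W u t w) * \1_A w.
Proof.
have [wA|wA] := pselect (A w); last first.
  by rewrite indicE memNset// mulr0; under eq_fun do rewrite mulr0; exact: cvg_cst.
apply: cvgM; last exact: cvg_cst.
by apply: continuous_cvg; [exact: cg|exact: cvg_approx].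
Qed.

(** A process evaluated at a random time is not obviously measurable; here it is a pointwise limit
    of finite sums over cells. *)
Lemma word_measurable :
  measurable_fun setT (fun w => g (particle_position tau W u t w) * \1_A w).
Proof.
apply: (measurable_fun_cvg approx_measurable) => w _; exact: cvg_word.
Qed.

Lemma word_integral :
  (\int[P]_w (g (particle_position tau W u t w) * \1_A w)%:E =
   P A * \int[heat t]_x (g x)%:E)%E.
Proof.
have M0 : 0 <= M by rewrite (le_trans (g0 0)).
have := @dominated_cvg _ _ _ P setT measurableT
  (fun m w => (g (approx_position m w) * \1_A w)%:E)
  (fun w => (g (particle_position tau W u t w) * \1_A w)%:E) (cst M%:E).
move=> /(_ _ _ _ _ _)/cvg_lim <-//.
- by apply: lim_near_cst => //; apply: nearW => m; exact: approx_integral.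
- by move=> m; apply/measurable_EFinP; exact: approx_measurable.
- by move=> w _; apply: cvg_EFin; [exact: nearW|exact: cvg_word].
- exact: finite_measure_integrable_cst.
- move=> m w _; rewrite lee_fin ger0_norm ?mulr_ge0//.
  rewrite indicE; case: (_ \in _); rewrite ?mulr1// ?mulr0//.
Qed.

End word.
End branching.

(** * Survival probabilities and the many-to-one formula *)

Section erlang.
Context (R : realType).

(** For [x >= 0], the distribution function of a sum of [n] independent exponential variables of
    rate one, or the probability that a Poisson variable of mean [x] is at least [n]. *)
Definition erlang_cdf (n : nat) (x : R) : R :=
  1 - \sum_(k < n) expR (- x) * (x ^+ k / k`!%:R).

Lemma erlang_cdf_diff n x :
  erlang_cdf n x - erlang_cdf n.+1 x = expR (- x) * (x ^+ n / n`!%:R).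
Proof. by rewrite /erlang_cdf big_ord_recr/=; ring. Qed.

(** Since e^-(x - y) e^-y = e^-x does not depend on [y], the convolution integrand is e^-y minus a
    polynomial in [y] and is integrated term by term. *)
Let primitive (n : nat) (x y : R) : R :=
  - expR (- y) + \sum_(k < n) expR (- x) * ((x - y) ^+ k.+1 / k.+1`!%:R).

Let primitive_derive n x (y : R) :
  is_derive y 1 (primitive n x) (erlang_cdf n (x - y) * expR (- y)).
Proof.
have -> : erlang_cdf n (x - y) * expR (- y) =
    expR (- y) - \sum_(k < n) expR (- x) * ((x - y) ^+ k / k`!%:R).
  rewrite /erlang_cdf mulrBl mul1r mulr_suml; congr (_ - _).
  apply: eq_bigr => k _; rewrite mulrAC -expRD; congr (expR _ * _); ring.
elim: n => [|n IH].
  rewrite (_ : primitive 0 x = fun y => - expR (- y)); last first.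
    by apply/funext => z; rewrite /primitive big_ord0 addr0.
  by apply: is_derive_eq; rewrite big_ord0 subr0; ring.
rewrite (_ : primitive n.+1 x = fun y => primitive n x y +
    expR (- x) * ((x - y) ^+ n.+1 / n.+1`!%:R)); last first.
  by apply/funext => z; rewrite /primitive big_ord_recr/= addrA.
have D : is_derive y 1 (fun y => expR (- x) * ((x - y) ^+ n.+1 / n.+1`!%:R))
    (- (expR (- x) * ((x - y) ^+ n / n`!%:R))).
  have n1 : n.+1%:R != 0 :> R by rewrite pnatr_eq0.
  have nf : n`!%:R != 0 :> R by rewrite pnatr_eq0 -lt0n fact_gt0.
  have d1 : is_derive y 1 (cst x - (id : R -> R)) (0 - 1) by exact: is_deriveB.
  rewrite sub0r in d1.
  have dX := is_deriveX n.+1 d1.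
  rewrite (_ : (fun y => _) =
    (expR (- x) / n.+1`!%:R) *: ((cst x - (id : R -> R)) ^+ n.+1)); last first.
    rewrite exprfctE; apply/funext => z.
    rewrite -[RHS]/(expR (- x) / n.+1`!%:R * (x - z) ^+ n.+1).
    by field; rewrite pnatr_eq0 -lt0n fact_gt0.
  apply: is_derive_eq; rewrite /GRing.scale/= factS natrM -[(_ - _) y]/(x - y).
  move: n1 nf; move: (n.+1%:R : R) (n`!%:R : R) => a b a0 b0.
  by field; rewrite a0 b0.
rewrite big_ord_recr/= opprD addrA; exact: is_deriveD.
Qed.

Lemma continuous_erlang_cdf n : continuous (erlang_cdf n).
Proof.
move=> x; apply: cvgB; first exact: cvg_cst.
apply: cvg_big => [|k _]; first exact: add_continuous.
apply: cvgM; last by apply: cvgM; [exact: exprn_continuous|exact: cvg_cst].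
apply: (continuous_comp (g := expR)); first exact: opp_continuous.
exact: continuous_expR.
Qed.

Lemma erlang_convolution n (x : R) : 0 < x ->
  (\int[lebesgue_measure]_(y in `[0%R, x]) (erlang_cdf n (x - y) * expR (- y))%:E =
   (erlang_cdf n.+1 x)%:E)%E.
Proof.
move=> x0.
have cont (F dF : R -> R) : (forall y : R, is_derive y 1 F (dF y)) -> continuous F.
  by move=> dFP y; apply: differentiable_continuous; apply/derivable1_diffP.
have cF := cont _ _ (primitive_derive n x).
rewrite (continuous_FTC2 (F := primitive n x))//.
- rewrite /primitive subrr subr0 oppr0 expR0 -EFinB; congr EFin.
  rewrite /erlang_cdf big_ord_recl/= expr0 fact0 divr1 mulr1.
  rewrite [X in _ + X - _]big1 ?addr0; last first.
    by move=> k _; rewrite expr0n/= mul0r mulr0.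
  by ring.
- apply: continuous_subspaceT => y; apply: cvgM.
    apply: (continuous_comp (f := fun z => x - z)); last exact: continuous_erlang_cdf.
    by apply: cvgB; [exact: cvg_cst|exact: cvg_id].
  apply: (continuous_comp (g := expR)); first exact: opp_continuous.
  exact: continuous_expR.
- split.
  + by move=> y _; have [] := primitive_derive n x y.
  + by apply: cvg_at_right_filter; exact: cF.
  + by apply: cvg_at_left_filter; exact: cF.
- by move=> y _; rewrite derive1E; have [] := primitive_derive n x y.
Qed.

End erlang.

Section lifetimes_law.
Context d (Omega : measurableType d) (R : realType) (P : probability Omega R).
Variables (tau : seq bool -> Omega -> R) (W : seq bool -> R -> Omega -> R).
Hypothesis bbm : binary_branching_bm P tau W.

Let mtau v : measurable_fun setT (tau v).
Proof. exact: bbm_lifetime_measurable bbm v. Qed.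

Lemma lifetimes_indep : mutually_independent P (fun v => sigma_rv (tau v)).
Proof.
move=> s E us HE.
have := @bbm_independent _ _ _ _ _ _ bbm (map inl s)
  (fun i => if i is inl v then E v else setT).
rewrite big_map map_inj_uniq; last by move=> ? ? [].
move=> <-//.
  congr (P _); apply/seteqP; split => w H.
    by move=> [v|v] //= /mapP[v' vs [->]]; exact: H.
  move=> v vs; apply: (H (inl v)) => /=; rewrite mem_map// => ? ? [] //.
move=> [v|v] /mapP[v' vs] //= [->]; exact: HE.
Qed.

Lemma lifetime_ge0 v : P [set w | 0 <= tau v w] = 1%E.
Proof.
have m0 : measurable ([set` `[0, +oo[] : set R) by exact: measurable_itv.
have := bbm_lifetime_exponential bbm v m0.
rewrite (_ : [set w | _] = [set w | 0 <= tau v w]); last first.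
  by apply/seteqP; split => w /=; rewrite in_itv/= andbT.
move=> ->; rewrite /exponential_prob.
rewrite -(@integral_exponential_pdf R 1)// [LHS]integral_mkcond.
apply: eq_integral => x _; rewrite patchE; case: ifPn => // /negP xn.
rewrite lt0_exponential_pdf// ltNge; apply/negP => x0; apply: xn.
by rewrite inE/= in_itv/= x0.
Qed.

Lemma lifetimes_ge0_prob u : P (lifetimes_ge0 tau u) = 1%E.
Proof.
rewrite (_ : lifetimes_ge0 tau u =
    rectangle tau (ancestors u) (fun=> [set` `[0, +oo[])); last first.
  apply/seteqP; split => w H.
    move=> _ /= /mapP[k + ->]; rewrite mem_iota/= add0n in_itv/= andbT => ku.
    exact: (H (Ordinal ku)).
  move=> k; have /= := H (take k u); rewrite in_itv/= andbT; apply.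
  by apply: mem_ancestors; exact: leq_ord.
rewrite (rectangle_prob lifetimes_indep)//; last exact: uniq_ancestors.
rewrite big1// => v _; rewrite -(lifetime_ge0 v); congr (P _).
by apply/seteqP; split => w /=; rewrite in_itv/= andbT.
Qed.

Lemma birth_time_rcons u b w :
  birth_time tau (rcons u b) w = birth_time tau u w + tau u w.
Proof.
rewrite /birth_time size_rcons big_ord_recr/=; congr (_ + _).
  by apply: eq_bigr => k _; rewrite -cats1 takel_cat// ltnW.
by rewrite -cats1 takel_cat// take_size.
Qed.

(** The birth time is a function of the lifetimes of the strict ancestors, listed in [s], to which
    [u] does not belong. *)
Lemma birth_lifetime_indep u (A C : set R) : measurable A -> measurable C ->
  P (birth_time tau u @^-1` A `&` tau u @^-1` C) =
  (P (birth_time tau u @^-1` A) * P (tau u @^-1` C))%E.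
Proof.
move=> mA mC.
pose s := [seq take k u | k <- iota 0 (size u)].
have us : uniq s.
  by have := uniq_ancestors u; rewrite /ancestors -addn1 iotaD map_cat cat_uniq => /and3P[].
have uNs : u \notin s.
  apply/negP => /mapP[k]; rewrite mem_iota/= add0n => ku /(congr1 size).
  by rewrite size_ancestor ?(ltnW ku)// => uk; rewrite -uk ltnn in ku.
have mE : measurable (tau u @^-1` C) by rewrite -[X in measurable X]setTI; exact: mtau.
apply: (g_rectangle_indep mtau (s := s) mE).
  move=> B mB.
  pose B' v : set R := if v == u then C else B v.
  have mB' v : measurable (B' v) by rewrite /B'; case: ifP.
  have BB' : rectangle tau s B = rectangle tau s B'.
    apply: eq_bigcapr => v /= vs; rewrite /B' (negbTE (_ : v != u))//.
    by apply: contraNneq uNs => <-.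
  rewrite BB' setIC.
  have -> : tau u @^-1` C `&` rectangle tau s B' = rectangle tau (u :: s) B'.
    by rewrite rectangle_cons /B' eqxx.
  rewrite !(rectangle_prob lifetimes_indep)//=; last by rewrite uNs.
  by rewrite big_cons /B' eqxx muleC.
set G := [set rectangle _ _ _ | _ in _].
have mt k : (k < size u)%N ->
    measurable_fun setT (tau (take k u) : g_sigma_algebraType G -> R).
  move=> ku _ Y mY; rewrite setTI; apply: sub_sigma_algebra.
  exists (fun v => if v == take k u then Y else setT).
    by move=> v; case: ifP.
  apply/seteqP; split => w /= H.
    have := H (take k u); rewrite eqxx; apply => /=.
    by apply/mapP; exists k; rewrite // mem_iota.
  by move=> v _; case: eqP => [->|].
have : measurable_fun setT (birth_time tau u : g_sigma_algebraType G -> R).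
  by apply: measurable_sum => k; exact: mt.
by move=> /(_ measurableT _ mA); rewrite setTI.
Qed.

Lemma birth_time_cdf u (x : R) : P [set w | birth_time tau u w <= x] =
  (if x < 0 then 0 else erlang_cdf (size u) x)%:E.
Proof.
elim/last_ind: u x => [|u b IH] x.
  rewrite /erlang_cdf big_ord0 subr0.
  rewrite (_ : [set w | _] = if 0 <= x then setT else set0); last first.
    by apply/seteqP; split => w /=; rewrite /birth_time big_ord0; case: ifP.
  by rewrite ltNge; case: ifP => _ /=; rewrite ?measure0 ?probability_setT.
pose S := birth_time tau u.
have mS : measurable_fun setT S by exact: measurable_birth_time.
pose X : {mfun Omega >-> measurableTypeR R} :=
  HB.pack S (isMeasurableFun.Build _ _ _ (measurableTypeR R) S mS).
have [mu1 mu1E] : exists mu1 : probability (measurableTypeR R) R,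
    forall A, mu1 A = exponential_prob (1 : R) A.
  by unshelve eexists (exponential_prob (1 : R)).
(* The lifetime comes first, so that the section of [D] at [y] is the half-line below [x - y], whose
   probability is the induction hypothesis. *)
pose V w : measurableTypeR R * measurableTypeR R := (tau u w, S w).
have mV : measurable_fun setT V by apply/measurable_fun_pair; [exact: mtau|exact: mS].
pose D : set (measurableTypeR R * measurableTypeR R) := [set z | z.2 + z.1 <= x].
have mD : measurable D.
  have h : measurable_fun setT (fun z : measurableTypeR R * measurableTypeR R => z.2 + z.1).
    exact: measurable_funD.
  have := measurable_fun_le measurableT h (@measurable_cst _ _ _ _ setT x).
  by rewrite setTI.
have -> : [set w | birth_time tau (rcons u b) w <= x] = V @^-1` D.
  by apply/seteqP; split => w /=; rewrite birth_time_rcons.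
have lawS (z : R) : distribution P X [set y | y <= z] =
    (if z < 0 then 0 else erlang_cdf (size u) z)%:E by rewrite -IH.
have lawV (A C : set R) : measurable A -> measurable C ->
    P (V @^-1` (A `*` C)) = (1%:E * (mu1 A * distribution P X C))%E.
  move=> mA mC; rewrite mul1e mu1E -(bbm_lifetime_exponential bbm u mA) muleC.
  by rewrite -(birth_lifetime_indep u mC mA) setIC.
rewrite (@pushforward_product _ _ _ _ _ _ _ P mu1 (distribution P X) V 1)//.
rewrite mul1e /product_measure1/=.
have cdf_ge0 (z : R) : 0 <= (if z < 0 then 0 else erlang_cdf (size u) z).
  by rewrite -lee_fin -lawS measure_ge0.
rewrite size_rcons.
pose h (y : R) : R := if x - y < 0 then 0 else erlang_cdf (size u) (x - y).
transitivity (\int[mu1]_y (h y)%:E)%E.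
  apply: eq_integral => y _; rewrite -lawS; congr (distribution P X _).
  by apply/seteqP; split => z; rewrite /xsection/= inE /D/= lerBrDr.
have mh : measurable_fun setT h.
  apply: measurable_fun_ifT.
  - by apply: measurable_fun_ltr => //; exact: measurable_funB.
  - exact: measurable_cst.
  - apply: measurableT_comp; last exact: measurable_funB.
    exact: continuous_measurable_fun (@continuous_erlang_cdf _ _).
have pdf0 (y : R) : 0 <= exponential_pdf (1 : R) y by exact: exponential_pdf_ge0.
have -> : (\int[mu1]_y (h y)%:E =
    \int[lebesgue_measure]_y ((h y)%:E * (exponential_pdf 1 y)%:E))%E.
  apply: ge0_integral_density.
  - exact: measurable_exponential_pdf.
  - exact: pdf0.
  - by move=> A mA; exact: mu1E.
  - exact/measurable_EFinP.
  - by move=> y; rewrite lee_fin; exact: cdf_ge0.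
transitivity (\int[lebesgue_measure]_(y in `[0%R, x])
    (erlang_cdf (size u) (x - y) * expR (- y))%:E)%E.
  rewrite [RHS]integral_mkcond; apply: eq_integral => y _.
  rewrite patchE; case: ifPn => [/set_mem|/negP yn].
    rewrite /= in_itv/= => /andP[y0 yx].
    rewrite /h ltNge subr_ge0 yx/= exponential_pdfE//.
    by rewrite mul1r mulN1r.
  rewrite /h; have [xy|yx] := ltP (x - y) 0; first by rewrite mul0e.
  rewrite lt0_exponential_pdf ?mule0// ltNge; apply/negP => y0; apply: yn.
  by rewrite inE/= in_itv/= y0 -subr_ge0.
have [x0|x0|->] := ltgtP x 0.
- by rewrite set_itv_ge ?integral_set0// bnd_simp -ltNge.
- exact: erlang_convolution.
- rewrite set_itv1 integral_set1; congr EFin.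
  rewrite /erlang_cdf big_ord_recl/= oppr0 expR0 expr0 fact0 divr1 mulr1.
  by rewrite big1 ?addr0 ?subrr// => k _; rewrite expr0n/= mul0r mulr0.
Qed.

(** A word is alive at [t] when it is born by then and its children are not; the difference of two
    consecutive Erlang distribution functions is a Poisson weight. *)
Lemma alive_lifetimes_prob u (t : R) : 0 <= t ->
  P ([set w | alive tau t w u] `&` lifetimes_ge0 tau u) =
  (expR (- t) * (t ^+ size u / (size u)`!%:R))%:E.
Proof.
move=> t0; set A := [set w | alive tau t w u].
have mS v : measurable_fun setT (birth_time tau v) by exact: measurable_birth_time.
have mle v : measurable [set w | birth_time tau v w <= t].
  have := measurable_fun_le measurableT (mS v) (@measurable_cst _ _ _ _ setT t).
  by rewrite setTI.
pose B := [set w | birth_time tau (rcons u false) w <= t].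
have mA : measurable A by exact: measurable_alive.
have mB : measurable B by exact: mle.
have disj : A `&` B = set0.
  apply/seteqP; split => // w [] /andP[_ tw]; rewrite /B/= birth_time_rcons.
  by rewrite leNgt tw.
have mN : measurable (lifetimes_ge0 tau u) by exact: measurable_lifetimes_ge0.
have restr (C : set Omega) : measurable C -> P (C `&` lifetimes_ge0 tau u) = P C.
  move=> mC; rewrite [RHS](measureDI P mC mN) setDE.
  rewrite [X in (X + _)%E](_ : _ = 0) ?add0e//.
  apply: (@subset_measure0 _ _ _ P _ (~` lifetimes_ge0 tau u)) => //.
  - by apply: measurableI => //; exact: measurableC.
  - exact: measurableC.
  - rewrite /= probability_setC// lifetimes_ge0_prob subee//.
(* That a child is born after its parent requires a nonnegative lifetime, hence the restriction to
   [lifetimes_ge0] before the two events are compared. *)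
have H : P [set w | birth_time tau u w <= t] = (P A + P B)%E.
  rewrite -[LHS](restr _ (mle u)) -[P A]restr// -[P B]restr//.
  rewrite -measureU//; last 3 first.
  - exact: measurableI.
  - exact: measurableI.
  - by rewrite setIACA setIid disj set0I.
  rewrite -setIUl; congr (P _); apply/seteqP; split => w [/= Cw Nw]; split => //.
    have [bt|tb] := leP (birth_time tau u w + tau u w) t.
      by right; rewrite /B/= birth_time_rcons.
    by left; rewrite /A/alive/= Cw.
  case: Cw => [/andP[]//|]; rewrite /B/= birth_time_rcons; apply: le_trans.
  by rewrite lerDl; have := Nw ord_max; rewrite /= take_size.
rewrite restr//.
have {}H : P A = (P [set w | (birth_time tau u w <= t)%R] - P B)%E.
  by rewrite H addeK// fin_num_measure.
by rewrite H !birth_time_cdf size_rcons ltNge t0/= -EFinB erlang_cdf_diff.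
Qed.

End lifetimes_law.

Lemma card_eq_seq (T : eqType) (s : seq T) : uniq s ->
  ([set` s] #= `I_(size s))%card.
Proof.
move=> us; apply/card_set_bijP; exists (index ^~ s); split.
- by move=> x /= xs; rewrite index_mem.
- by move=> x y /set_mem/= xs /set_mem/= ys xy; rewrite -(nth_index x xs) xy nth_index.
- move=> k /= ks; case: s ks us => // x0 s ks us.
  exists (nth x0 (x0 :: s) k); first exact: mem_nth.
  exact: index_uniq.
Qed.

Section expectation.
Context d (Omega : measurableType d) (R : realType) (P : probability Omega R).
Variables (tau : seq bool -> Omega -> R) (W : seq bool -> R -> Omega -> R).
Hypothesis bbm : binary_branching_bm P tau W.

Let mtau v : measurable_fun setT (tau v).
Proof. exact: bbm_lifetime_measurable bbm v. Qed.

Section fixed_time.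
Variable t : R.
Hypothesis t0 : 0 <= t.

Let live u := [set w | alive tau t w u] `&` lifetimes_ge0 tau u.

Let mlive u : measurable (live u).
Proof.
by apply: measurableI;
  [exact: measurable_alive|exact: measurable_lifetimes_ge0].
Qed.

(** The series is e^-t e^(2t). The factor [K] is the Gaussian expectation in [many_to_one] and 1 in
    the Borel-Cantelli argument. *)
Lemma live_series (K : R) :
  (\sum_(0 <= m <oo) \sum_(u : m.-tuple bool) (P (live u) * K%:E) =
   (expR t)%:E * K%:E)%E.
Proof.
have termE m : (\sum_(u : m.-tuple bool) (P (live u) * K%:E) =
    (expR (- t) * exp_coeff (2 * t) m)%:E * K%:E)%E.
  under eq_bigr => u _ do
    rewrite (alive_lifetimes_prob bbm)// size_tuple.
  rewrite -ge0_sume_distrl; last first.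
    by move=> u _; rewrite lee_fin mulr_ge0 ?expR_ge0// divr_ge0 ?exprn_ge0.
  rewrite sumEFin sumr_const cardT/= -cardE card_tuple card_bool.
  congr (_%:E * _)%E; rewrite -[LHS]mulr_natl natrX /exp_coeff/= exprMn.
  by rewrite mulrCA !mulrA.
rewrite (eq_eseriesr (fun m _ => termE m)).
under eq_eseriesr do rewrite muleC.
have c0 m : 0 <= expR (- t) * exp_coeff (2 * t) m.
  by rewrite mulr_ge0 ?expR_ge0// exp_coeff_ge0// mulr_ge0.
have S : (\sum_(0 <= m <oo) (expR (- t) * exp_coeff (2 * t) m)%:E = (expR t)%:E)%E.
  apply/cvg_lim => //; under eq_fun do rewrite sumEFin.
  apply: cvg_EFin; first exact: nearW.
  under eq_fun do rewrite /= -mulr_sumr.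
  rewrite (_ : expR t = expR (- t) * expR (2 * t)); last first.
    by rewrite -expRD; congr expR; ring.
  by apply: cvgMl_tmp; exact: is_cvg_series_exp_coeff.
by rewrite nneseriesZl ?S 1?muleC// => m _; rewrite lee_fin.
Qed.

(** There are countably many finite lists of words, so the event is split according to the list of
    live words. *)
Lemma measurable_population n : measurable (population_eq tau t n).
Proof.
have -> : population_eq tau t n = \bigcup_(s : seq (seq bool))
    (if uniq s && (size s == n) then
       \bigcap_(u : seq bool) (if u \in s then [set w | alive tau t w u]
                               else ~` [set w | alive tau t w u])
     else set0).
  apply/seteqP; split => w.
    move=> wn; have /finite_seqP[s ws] : finite_set (alive tau t w) by exists n.
    exists (undup s) => //; rewrite undup_uniq/=.
    have us : ([set` undup s] #= `I_n)%card.
      rewrite (_ : [set` undup s] = alive tau t w)//.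
      by rewrite ws; apply/seteqP; split => u /=; rewrite mem_undup.
    have : (`I_(size (undup s)) #= `I_n)%card.
      by rewrite card_eq_sym (card_eq_trans _ (card_eq_seq (undup_uniq s)))// card_eq_sym.
    move=> /card_eq_II ->; rewrite eqxx => u _; rewrite mem_undup.
    have su : alive tau t w u <-> u \in s by rewrite ws.
    by case: ifPn => [/su//|/negP nus /su].
  move=> [s _]; case: ifPn => // /andP[us /eqP <-] H.
  rewrite /population_eq/= (_ : alive tau t w = [set` s]); first exact: card_eq_seq.
  have Hs u : alive tau t w u <-> u \in s by have := H u I; case: ifPn => us'; split.
  by apply/seteqP; split => u /Hs.
apply: countable_bigcupT_measurable => [|s]; first exact: countableP.
case: ifP => // _.
rewrite -[X in measurable X]setCK setC_bigcap; apply: measurableC.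
apply: countable_bigcupT_measurable => [|u]; first exact: countableP.
apply: measurableC.
have mu : measurable [set w | alive tau t w u] by exact: measurable_alive.
by case: ifP => // _; exact: measurableC.
Qed.

Lemma trivIset_population : trivIset setT (population_eq tau t).
Proof.
apply/trivIsetP => i j _ _ ij; apply/seteqP; split => // w [/= wi wj].
have : (`I_i #= `I_j)%card by rewrite (card_eq_trans _ wj)// card_eq_sym.
by move/card_eq_II => ijE; rewrite ijE eqxx in ij.
Qed.

Lemma ae_lifetimes_ge0 : {ae P, forall w, forall u, 0 <= tau u w}.
Proof.
have : {ae P, forall w, forall k, if unpickle k is Some u then 0 <= tau u w else true}.
  apply: ae_foralln => k; case: unpickle => [u|]; last exact: nearW.
  have mN : measurable [set w | 0 <= tau u w].
    have := measurable_fun_le measurableT (@measurable_cst _ _ Omega R setT 0) (@mtau u).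
    by rewrite setTI.
  exists (~` [set w | 0 <= tau u w]); split => //; first exact: measurableC.
  by rewrite /= probability_setC// (lifetime_ge0 bbm) subee.
by apply: filterS => w H u; have := H (pickle u); rewrite pickleK.
Qed.

(* Borel-Cantelli over the generations. *)
Lemma ae_finite_population :
  {ae P, forall w, exists n, population_eq tau t n w}.
Proof.
pose F m := \big[setU/set0]_(u : m.-tuple bool) live u.
have mF m : measurable (F m) by exact: bigsetU_measurable.
have PF : P (lim_sup_set F) = 0%E.
  apply: lim_sup_set_cvg0 => //.
  apply: (@le_lt_trans _ _ (\sum_(0 <= m <oo) \sum_(u : m.-tuple bool) (P (live u) * 1))%E).
    apply: lee_nneseries => [m _ _|m _]; first exact: measure_ge0.
    under eq_bigr do rewrite mule1.
    suff [] : measurable (F m) /\ (P (F m) <= \sum_(u : m.-tuple bool) P (live u))%E by [].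
    apply: (big_ind2 (fun A x => measurable A /\ (P A <= x)%E)) => //.
      by rewrite measure0.
    move=> A x B y [mA Ax] [mB By]; split; first exact: measurableU.
    by rewrite (le_trans (measureU2 _ mA mB))// leeD.
  by rewrite live_series// mule1 ltry.
have : {ae P, forall w, ~ lim_sup_set F w}.
  exists (lim_sup_set F); split => //.
    by apply: bigcap_measurable => // k _; apply: bigcup_measurable => m _.
  by move=> w /= /contrapT.
apply: filterS2 ae_lifetimes_ge0 => w t_ge0 nF.
have {nF} [N nF] : exists N, forall m, (N <= m)%N -> ~ F m w.
  apply: contrapT => H; apply: nF => N _; apply: contrapT => H'.
  by apply: H; exists N => m Nm Fm; apply: H'; exists m.
suff : finite_set (alive tau t w) by [].
(* Live words belong to the generations below [N], each of which is finite. *)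
apply: (@sub_finite_set _ _ (\bigcup_(m in `I_N) [set` map val (enum {: m.-tuple bool})])).
  move=> u uw; exists (size u) => /=.
    rewrite ltnNge; apply/negP => /nF; apply; rewrite /F.
    rewrite -bigcup_seq; exists (in_tuple u); first by rewrite /= mem_index_enum.
    by split => // k; exact: t_ge0.
  by apply/mapP; exists (in_tuple u) => //; rewrite mem_enum.
by apply: bigcup_finite => // m _; exact: finite_seq.
Qed.

Variables (M : R) (g : R -> R) (X : nat -> R -> Omega -> R).
Hypothesis cg : continuous g.
Hypothesis g0 : forall x, 0 <= g x.
Hypothesis gM : forall x, g x <= M.
Hypothesis mX : forall k, measurable_fun setT (X k t).
Hypothesis labels : labels_particles tau W X.

Let G u w := g (particle_position tau W u t w) * \1_(live u) w.

Let G0 u w : 0 <= G u w.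
Proof. by rewrite mulr_ge0. Qed.

Let mG u : measurable_fun setT (G u).
Proof. exact: (word_measurable bbm u t0 cg). Qed.

Let total w : \bar R := (\sum_(0 <= m <oo) \sum_(u : m.-tuple bool) (G u w)%:E)%E.

Let total_ge0 w : (0 <= total w)%E.
Proof. by apply: nneseries_ge0 => m _ _; apply: sume_ge0 => u _; rewrite lee_fin. Qed.

Let mtotal : measurable_fun setT total.
Proof.
apply: ge0_emeasurable_sum => [m w _ _|m _].
  by apply: sume_ge0 => u _; rewrite lee_fin.
by apply: emeasurable_sum => u; apply/measurable_EFinP; exact: mG.
Qed.

(** The labelling is a bijection onto the live words, so its order disappears in the sum. *)
Let total_population n w : (forall u, 0 <= tau u w) -> population_eq tau t n w ->
  total w = (\sum_(k < n) g (X k t w))%:E.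
Proof.
move=> t_ge0 wn; have [l [ls li lj] Xl] := labels t0 wn.
pose c (k : 'I_n) := g (X k t w).
have GE u : G u w = \sum_(k < n) (l k == u)%:R * c k.
  have [uw|nuw] := pselect (alive tau t w u).
    rewrite /G indicE mem_set ?mulr1//; last by split => // k; exact: t_ge0.
    have [k kn lk] := lj _ uw.
    rewrite (bigD1 (Ordinal kn))//= lk eqxx mul1r big1 ?addr0; last first.
      move=> i ik; case: eqP => [lik|]; last by rewrite mul0r.
      have ik' : i = k :> nat by apply: li; rewrite ?inE//= ?lik ?lk.
      by move/eqP: ik; case; exact/val_inj.
    by rewrite /c/= Xl// lk.
  rewrite /G indicE memNset; last by case.
  rewrite mulr0 big1// => k _; case: eqP => [lk|]; last by rewrite mul0r.
  by case: nuw; rewrite -lk; apply: ls; exact: (ltn_ord k).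
(* Beyond the last generation with a live particle the partial sums are constant. *)
pose N := (\max_(k < n) size (l k)).+1.
have sumG m : \sum_(u : m.-tuple bool) G u w = \sum_(k < n) (size (l k) == m)%:R * c k.
  under eq_bigr do rewrite GE.
  rewrite exchange_big/=; apply: eq_bigr => k _; rewrite -mulr_suml; congr (_ * _).
  have [lkm|lkm] := eqVneq (size (l k)) m; last first.
    rewrite big1// => u _; case: eqP => // lku.
    by rewrite lku size_tuple eqxx in lkm.
  rewrite (bigD1 (Tuple (introT eqP lkm)))//= eqxx big1 ?addr0// => u uk.
  case: eqP => // lku; move/eqP: uk; case; apply/val_inj; exact/esym.
rewrite /total; under eq_eseriesr do rewrite sumEFin sumG.
apply/cvg_lim => //; apply: (@cvg_near_cst _ _ _ _ _ _).
exists N => // m /= Nm.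
rewrite sumEFin; congr EFin; rewrite exchange_big/=; apply: eq_bigr => k _.
rewrite -mulr_suml (bigD1_seq (size (l k)))/= ?iota_uniq//; last first.
  rewrite mem_index_iota/= (leq_trans _ Nm)// ltnS.
  exact: (leq_bigmax k).
by rewrite eqxx big1 ?addr0 ?mul1r// => i; rewrite eq_sym => /negbTE ->.
Qed.

(** Both sides are the expectation of [total]: split by population size on the left, where the
    infinite populations form a null set, and summed word by word on the right. *)
Lemma many_to_one :
  (\sum_(0 <= n <oo) \int[P]_(w in population_eq tau t n) (\sum_(k < n) g (X k t w))%:E =
   (expR t)%:E * \int[heat t]_x (g x)%:E)%E.
Proof.
have mg : measurable_fun setT g by exact: continuous_measurable_fun.
have Kfin : (\int[heat t]_x (g x)%:E)%E \is a fin_num.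
  apply: integrable_fin_num => //; apply: (heat_integrable t mg (M := M)) => x.
  by rewrite ger0_norm.
have mU : measurable (\bigcup_n population_eq tau t n).
  by apply: bigcup_measurable => n _; exact: measurable_population.
transitivity (\int[P]_w total w)%E; last first.
  rewrite /total integral_nneseries//.
  - rewrite -(fineK Kfin) -live_series; apply: eq_eseriesr => m _.
    rewrite ge0_integral_sum//.
    + apply: eq_bigr => u _; rewrite fineK//; exact: (word_integral bbm u t0 cg g0 gM).
    + by move=> u; exact/measurable_EFinP.
    + by move=> u w _; rewrite lee_fin.
  - by move=> m; apply: emeasurable_sum => u; exact/measurable_EFinP.
  - by move=> m w _; apply: sume_ge0 => u _; rewrite lee_fin.
transitivity (\int[P]_(w in \bigcup_n population_eq tau t n) total w)%E; last first.
  rewrite [RHS](@ge0_negligible_integral _ _ _ _ _ (~` \bigcup_n population_eq tau t n))//.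
  - by rewrite setTD setCK.
  - exact: measurableC.
  - have [N [mN PN NU]] := ae_finite_population.
    apply: (@subset_measure0 _ _ _ P _ N) => //; first exact: measurableC.
    by move=> w nw; apply: NU => -[n wn]; apply: nw; exists n.
rewrite ge0_integral_bigcup//.
- apply: eq_eseriesr => n _; apply: ge0_ae_eq_integral.
  + exact: measurable_population.
  + apply/measurable_EFinP/measurable_funTS; apply: measurable_sum => k.
    exact: measurableT_comp.
  + exact: measurable_funTS.
  + by move=> w _; rewrite lee_fin sumr_ge0.
  + by move=> w _.
  + by apply: filterS ae_lifetimes_ge0 => w t_ge0 wn; exact/esym/total_population.
- by move=> n; exact: measurable_population.
- exact: measurable_funTS.
- exact: trivIset_population.
Qed.

End fixed_time.
End expectation.

(** * Integration against [lebesgue_tuple] *)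

Section lebesgue_tuple_integral.
Context (R : realType).

Lemma measurable_tuple_cons n : measurable_fun setT
  (@tuple_cons R n : measurableTypeR R * n.-tuple R -> n.+1.-tuple R).
Proof. exact: (@measurable_cons _ _ _ _ fst n snd). Qed.

Lemma measurable_tuple_rcons n : measurable_fun setT
  (fun z : measurableTypeR R * n.-tuple R => [tuple of rcons z.2 z.1]).
Proof.
apply/measurable_fun_tnthP => i.
have [k ->|->] := unliftP ord_max i.
  rewrite (_ : _ \o _ = fun z : measurableTypeR R * n.-tuple R => tnth z.2 k).
    exact: (measurableT_comp (measurable_tnth k) measurable_snd).
  apply/funext => z /=; rewrite !(tnth_nth 0)/= nth_rcons size_tuple /bump.
  have kn : (k < n)%N := ltn_ord k.
  by rewrite (leqNgt n k) kn/= add0n kn.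
rewrite (_ : _ \o _ = fst); first exact: measurable_fst.
by apply/funext => z /=; rewrite (tnth_nth 0)/= nth_rcons size_tuple ltnn eqxx.
Qed.

Lemma tnth_rcons_max n (y : n.-tuple R) x : tnth [tuple of rcons y x] ord_max = x.
Proof. by rewrite (tnth_nth x)/= nth_rcons size_tuple ltnn eqxx. Qed.

Lemma ge0_integral_cons n (f : n.+1.-tuple R -> \bar R) :
  measurable_fun setT f -> (forall z, 0 <= f z)%E ->
  (\int[lebesgue_tuple R n.+1]_z f z =
   \int[lebesgue_measure]_x \int[lebesgue_tuple R n]_y f (tuple_cons (x, y)))%E.
Proof.
move=> mf f0.
transitivity (\int[pushforward (lebesgue_measure \x lebesgue_tuple R n)%E
    (@tuple_cons R n : measurableTypeR R * n.-tuple R -> n.+1.-tuple R)]_z f z)%E.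
  apply: eq_measure_integral; first exact: measurable_tuple_cons.
  by move=> mc A mA _.
rewrite ge0_integral_pushforward//; last exact: measurable_tuple_cons.
rewrite preimage_setT fubini_tonelli1//.
  exact: (measurableT_comp mf (@measurable_tuple_cons n)).
by move=> z; exact: f0.
Qed.

(** [lebesgue_tuple] separates the first coordinate, while the concentration freezes the last one.
    By induction: split off the first coordinate, apply the hypothesis to the others, and exchange
    the two outer integrals. *)
Lemma ge0_integral_rcons n (f : n.+1.-tuple R -> \bar R) :
  measurable_fun setT f -> (forall z, 0 <= f z)%E ->
  (\int[lebesgue_tuple R n.+1]_z f z =
   \int[lebesgue_measure]_x \int[lebesgue_tuple R n]_y f [tuple of rcons y x])%E.
Proof.
elim: n f => [|n IH] f mf f0.
  rewrite (ge0_integral_cons mf f0); apply: eq_integral => x _.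
  apply: eq_integral => y _; congr f; apply/val_inj.
  by rewrite /= (tuple0 y).
rewrite (ge0_integral_cons mf f0).
pose F (z : measurableTypeR R * measurableTypeR R * n.-tuple R) :=
  f (tuple_cons (z.1.1, [tuple of rcons z.2 z.1.2])).
have mF : measurable_fun setT F.
  have m2 : measurable_fun setT
      (fun z : measurableTypeR R * measurableTypeR R * n.-tuple R => (z.1.2, z.2)).
    apply/measurable_fun_pair => /=; last exact: measurable_snd.
    exact: (measurableT_comp measurable_snd measurable_fst).
  have m1 : measurable_fun setT
      (fun z : measurableTypeR R * measurableTypeR R * n.-tuple R =>
        (z.1.1, [tuple of rcons z.2 z.1.2])).
    apply/measurable_fun_pair => /=.
      exact: (measurableT_comp measurable_fst measurable_fst).
    exact: (measurableT_comp (@measurable_tuple_rcons n) m2).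
  exact: (measurableT_comp mf (measurableT_comp (@measurable_tuple_cons n.+1) m1)).
have mG := @measurable_fun_fubini_tonelli_F _ _ _ _ _ (lebesgue_tuple R n) F mF (fun z => f0 _).
transitivity (\int[lebesgue_measure]_a \int[lebesgue_measure]_x
    \int[lebesgue_tuple R n]_y F ((a, x), y))%E.
  apply: eq_integral => a _; rewrite IH//; last first.
    apply: (measurableT_comp mf (measurableT_comp (@measurable_tuple_cons n.+1) _)).
    exact: pair1_measurable.
rewrite (fubini_tonelli (fun z : measurableTypeR R * measurableTypeR R =>
  \int[lebesgue_tuple R n]_y F (z, y))%E)//; last first.
  by move=> z; apply: integral_ge0 => y _; exact: f0.
apply: eq_integral => x _.
have mfx : measurable_fun setT (fun z : n.+1.-tuple R => f [tuple of rcons z x]).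
  exact: (measurableT_comp mf
    (measurableT_comp (@measurable_tuple_rcons n.+1) (pair1_measurable _))).
rewrite (ge0_integral_cons mfx (fun z => f0 _)).
apply: eq_integral => a _; apply: eq_integral => y _; congr f.
exact/val_inj.
Qed.

Definition rotate n (z : n.+1.-tuple R) : n.+1.-tuple R :=
  [tuple tnth z (ordS i) | i < n.+1].

Lemma rotate_cons n x (y : n.-tuple R) :
  rotate (tuple_cons (x, y)) = [tuple of rcons y x].
Proof.
apply: eq_from_tnth => i; rewrite tnth_mktuple !(tnth_nth 0)/= nth_rcons size_tuple.
have := ltn_ord i; rewrite ltnS leq_eqVlt => /predU1P[->|ni].
  by rewrite modnn ltnn eqxx.
by rewrite modn_small ?ltnS//= ni.
Qed.

Lemma measurable_rotate n : measurable_fun setT (@rotate n).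
Proof.
apply/measurable_fun_tnthP => i.
rewrite (_ : _ \o _ = fun z : n.+1.-tuple R => tnth z (ordS i)).
  exact: measurable_tnth.
by apply/funext => z /=; rewrite tnth_mktuple.
Qed.

(** The rotation sends a [cons] to the corresponding [rcons], so the two decompositions of the
    integral coincide. *)
Lemma ge0_integral_rotate n (f : n.+1.-tuple R -> \bar R) :
  measurable_fun setT f -> (forall z, 0 <= f z)%E ->
  (\int[lebesgue_tuple R n.+1]_z f (rotate z) = \int[lebesgue_tuple R n.+1]_z f z)%E.
Proof.
move=> mf f0; rewrite (ge0_integral_rcons mf f0).
have mfr := measurableT_comp mf (@measurable_rotate n).
rewrite (ge0_integral_cons mfr (fun z => f0 _)).
by apply: eq_integral => x _; apply: eq_integral => y _; rewrite /= rotate_cons.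
Qed.

(* Invariance under the cyclic shift already makes all coordinates
   equivalent. *)
Section symmetric.
Variables (n : nat) (rho : n.+1.-tuple R -> R).
Hypothesis mrho : measurable_fun setT rho.
Hypothesis rho0 : forall z, 0 <= rho z.
Hypothesis rho_sym : {ae lebesgue_tuple R n.+1, forall z, rho (rotate z) = rho z}.
Variable g : R -> R.
Hypothesis mg : measurable_fun setT g.
Hypothesis g0 : forall x, 0 <= g x.

Let mfun_tnth k : measurable_fun setT (fun z : n.+1.-tuple R => rho z * g (tnth z k)).
Proof.
apply: measurable_funM => //; apply: measurableT_comp => //; exact: measurable_tnth.
Qed.

Let shift k :
  (\int[lebesgue_tuple R n.+1]_z (rho z * g (tnth z (ordS k)))%:E =
   \int[lebesgue_tuple R n.+1]_z (rho z * g (tnth z k))%:E)%E.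
Proof.
rewrite -[RHS]ge0_integral_rotate; last 2 first.
- by apply/measurable_EFinP; exact: mfun_tnth.
- by move=> z; rewrite lee_fin mulr_ge0.
apply: ge0_ae_eq_integral => //.
- by apply/measurable_EFinP; exact: mfun_tnth.
- apply/measurable_EFinP; apply: (measurableT_comp (mfun_tnth k)).
  exact: measurable_rotate.
- by move=> z _; rewrite lee_fin mulr_ge0.
- by move=> z _; rewrite lee_fin mulr_ge0.
- by apply: filterS rho_sym => z rz _; rewrite rz tnth_mktuple.
Qed.

Lemma symmetric_integral_last :
  (n.+1%:R%:E * \int[lebesgue_tuple R n.+1]_z (rho z * g (tnth z ord_max))%:E =
   \int[lebesgue_tuple R n.+1]_z (rho z * \sum_(k < n.+1) g (tnth z k))%:E)%E.
Proof.
have all_last (k : 'I_n.+1) :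
    (\int[lebesgue_tuple R n.+1]_z (rho z * g (tnth z k))%:E =
     \int[lebesgue_tuple R n.+1]_z (rho z * g (tnth z ord_max))%:E)%E.
  (* Induction on the distance to the last coordinate, each [shift] reducing it by one. *)
  move: {-2}(n - k)%N (erefl (n - k)%N) => j; elim: j k => [|j IH] k kj.
    congr integral; apply/funext => z; congr (rho _ * g (tnth _ _))%:E.
    apply/val_inj => /=; apply/eqP; move/esym/eqP: kj; rewrite subn_eq0 => nk.
    by rewrite eqn_leq nk andbT -ltnS ltn_ord.
  have kn : (k < n)%N by rewrite -subn_gt0 -kj.
  by rewrite -shift IH//= modn_small ?subnS -?kj.
under [RHS]eq_integral do rewrite mulr_sumr -sumEFin.
rewrite ge0_integral_sum//.
- under eq_bigr do rewrite all_last.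
  have -> : (n.+1%:R%:E = \sum_(k < n.+1) 1%:E :> \bar R)%E.
    by rewrite sumEFin sumr_const card_ord.
  by rewrite ge0_sume_distrl//; apply: eq_bigr => k _; rewrite mul1e.
- by move=> k; apply/measurable_EFinP; exact: mfun_tnth.
- by move=> k z _; rewrite lee_fin mulr_ge0.
Qed.

End symmetric.
End lebesgue_tuple_integral.

(** * The concentration field and its equation *)

Section concentration.
Context (R : realType) d (Omega : measurableType d) (P : probability Omega R).
Variables (tau : seq bool -> Omega -> R) (W : seq bool -> R -> Omega -> R).
Variables (X : nat -> R -> Omega -> R) (rho : forall n : nat, R -> n.-tuple R -> R).
Hypothesis bbm : binary_branching_bm P tau W.
Hypothesis mX : forall (k : nat) (t : R), 0 <= t -> measurable_fun setT (X k t).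
Hypothesis labels : labels_particles tau W X.
Hypothesis dens : symmetric_densities P tau X rho.

Section fixed_time.
Variable t : R.
Hypothesis t0 : 0 < t.

Let c := average_concentration rho t.

Let mrho m : measurable_fun setT (@rho m.+1 t).
Proof. exact: (density_measurable dens). Qed.

Let rho0 m z : 0 <= @rho m.+1 t z.
Proof. exact: (density_ge0 dens). Qed.

Let rho_sym m : {ae lebesgue_tuple R m.+1, forall z, rho t (rotate z) = rho t z}.
Proof.
have := density_symmetric dens (ltn0Sn m) t0 (perm (@ordS_inj m.+1)).
apply: filterS => z <-; congr (rho t _).
by apply: eq_from_tnth => i; rewrite !tnth_mktuple permE.
Qed.

(** Extends [density_law] from sets to functions: [rho] is the density of the image, under the
    positions, of [P] restricted to the population event. *)
Lemma population_density m (h : m.+1.-tuple R -> \bar R) :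
  measurable_fun setT h -> (forall z, 0 <= h z)%E ->
  (\int[lebesgue_tuple R m.+1]_z (h z * (rho t z)%:E) =
   \int[P]_(w in population_eq tau t m.+1) h [tuple X i t w | i < m.+1])%E.
Proof.
move=> mh h0.
have mpop : measurable (population_eq tau t m.+1).
  exact: (measurable_population bbm).
pose Y w := [tuple X i t w | i < m.+1].
have mY : measurable_fun setT Y.
  apply/measurable_fun_tnthP => i; rewrite (_ : _ \o _ = X i t).
    exact: mX (ltW t0).
  by apply/funext => w /=; rewrite tnth_mktuple.
rewrite -(@ge0_integral_density _ _ _ (lebesgue_tuple R m.+1)
  (measure_function_pushforward__canonical__measure_function_Measure (mrestr P mpop) mY))//.
  rewrite ge0_integral_pushforward// preimage_setT.
  rewrite (@ge0_integral_density _ _ _ P (mrestr P mpop) (\1_(population_eq tau t m.+1)))//.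
  - rewrite [RHS]integral_mkcond; apply: eq_integral => w _; rewrite patchE indicE.
    by case: ifPn => _; rewrite ?mule1 ?mule0.
  - by move=> B mB; rewrite integral_indic// /= /mrestr setIC.
  - exact: (measurableT_comp mh mY).
  - by move=> w; exact: h0.
  exact: mrho.
by move=> A mA; rewrite (density_law dens)// setIC.
Qed.

Lemma measurable_concentration : measurable_fun setT c.
Proof.
apply: ge0_emeasurable_sum => [m x _ _|m _].
  by rewrite mule_ge0// integral_ge0// => y _; rewrite lee_fin.
apply: measurable_funeM.
pose F (z : measurableTypeR R * m.-tuple R) := (rho t [tuple of rcons z.2 z.1])%:E.
have mF : measurable_fun setT F.
  apply/measurable_EFinP.
  exact: (measurableT_comp (@mrho m) (@measurable_tuple_rcons R m)).
have F0 z : (0 <= F z)%E by rewrite lee_fin.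
exact: (@measurable_fun_fubini_tonelli_F _ _ _ _ _ (lebesgue_tuple R m) F mF F0).
Qed.

Lemma concentration_ge0 x : (0 <= c x)%E.
Proof.
apply: nneseries_ge0 => m _ _.
by rewrite mule_ge0// integral_ge0// => y _; rewrite lee_fin.
Qed.

(** By symmetry of [rho], the factor [m.+1] times the last marginal is a sum over all coordinates,
    hence over all particles, and [many_to_one] applies. *)
Lemma concentration_integral (M : R) (g : R -> R) : continuous g ->
  (forall x, 0 <= g x) -> (forall x, g x <= M) ->
  (\int[lebesgue_measure]_x (c x * (g x)%:E) =
   (expR t)%:E * \int[heat t]_x (g x)%:E)%E.
Proof.
move=> cg g0 gM.
have mg : measurable_fun setT g by exact: continuous_measurable_fun.
have mXt k : measurable_fun setT (X k t) by exact: mX (ltW t0).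
rewrite -(many_to_one bbm (ltW t0) cg g0 gM mXt labels).
(* The empty population contributes an empty sum; dropping it aligns the indices with those of
   [c]. *)
rewrite [RHS]nneseries_recl//; last first.
  by move=> n _; apply: integral_ge0 => w _; rewrite lee_fin sumr_ge0.
under [X in (X + _)%E]eq_integral do rewrite big_ord0.
rewrite integral0 add0e.
rewrite -(nneseries_addn 1%N); last first.
  by move=> n; apply: integral_ge0 => w _; rewrite lee_fin sumr_ge0.
pose F m x := (m.+1%:R%:E *
  \int[lebesgue_tuple R m]_y (rho t [tuple of rcons y x] * g x)%:E)%E.
pose G m (z : measurableTypeR R * m.-tuple R) :=
  (rho t [tuple of rcons z.2 z.1] * g z.1)%:E.
have mG m : measurable_fun setT (G m).
  apply/measurable_EFinP/measurable_funM.
    exact: (measurableT_comp (@mrho m) (@measurable_tuple_rcons R m)).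
  exact: (measurableT_comp mg measurable_fst).
have G0 m z : (0 <= G m z)%E by rewrite lee_fin mulr_ge0.
have mrc m x : measurable_fun setT (fun y : m.-tuple R => rho t [tuple of rcons y x]).
  exact: (measurableT_comp (@mrho m)
    (measurableT_comp (@measurable_tuple_rcons R m) (pair1_measurable x))).
transitivity (\int[lebesgue_measure]_x \sum_(0 <= m <oo) F m x)%E.
  apply: eq_integral => x _; rewrite muleC -nneseriesZl; last first.
    by move=> m _; rewrite mule_ge0// integral_ge0// => y _; rewrite lee_fin.
  apply: eq_eseriesr => m _; rewrite muleCA; congr (_ * _)%E.
  rewrite -ge0_integralZl//.
  - by apply: eq_integral => y _; rewrite -EFinM mulrC.
  - by apply/measurable_EFinP; exact: mrc.
  - by move=> y _; rewrite lee_fin.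
  - by rewrite lee_fin.
rewrite integral_nneseries//; last 2 first.
- move=> m; apply: measurable_funeM.
  exact: (@measurable_fun_fubini_tonelli_F _ _ _ _ _ (lebesgue_tuple R m) (G m) (mG m) (G0 m)).
- by move=> m x _; rewrite mule_ge0// integral_ge0// => y _; exact: (G0 m (x, y)).
apply: eq_eseriesr => m _; rewrite addn1 ge0_integralZl//; last 2 first.
- exact: (@measurable_fun_fubini_tonelli_F _ _ _ _ _ (lebesgue_tuple R m) (G m) (mG m) (G0 m)).
- by move=> x _; apply: integral_ge0 => y _; exact: (G0 m (x, y)).
have mlast k : measurable_fun setT (fun z : m.+1.-tuple R => g (tnth z k)).
  by apply: measurableT_comp => //; exact: measurable_tnth.
transitivity (m.+1%:R%:E * \int[lebesgue_tuple R m.+1]_z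
    (rho t z * g (tnth z ord_max))%:E)%E.
  congr (_ * _)%E; rewrite ge0_integral_rcons.
  - by apply: eq_integral => x _; apply: eq_integral => y _; rewrite tnth_rcons_max.
  - by apply/measurable_EFinP/measurable_funM; [exact: mrho|exact: mlast].
  - by move=> z; rewrite lee_fin mulr_ge0.
rewrite symmetric_integral_last//.
under eq_integral do rewrite mulrC EFinM.
rewrite (@population_density m (fun z => (\sum_(k < m.+1) g (tnth z k))%:E)).
- apply: eq_integral => w _; congr EFin; apply: eq_bigr => k _.
  by rewrite tnth_mktuple.
- by apply/measurable_EFinP; exact: measurable_sum.
- by move=> z; rewrite lee_fin sumr_ge0.
Qed.

(** With [g = 1] the total mass is e^t, the mean population size. *)
Lemma integrable_concentration : lebesgue_measure.-integrable setT c.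
Proof.
apply/integrableP; split; first exact: measurable_concentration.
under eq_integral do rewrite gee0_abs ?concentration_ge0// -[c _]mule1.
rewrite (@concentration_integral 1 (cst 1))//; last exact: cst_continuous.
by rewrite (integral_cst _ measurableT 1) mul1e /= probability_setT mule1 ltry.
Qed.

(** [c] may be infinite, but only on a null set since it is integrable; a real-valued version allows
    subtraction. *)
Let c' x := fine (c x).

Let mc' : measurable_fun setT c'.
Proof. by apply: measurableT_comp => //; exact: measurable_concentration. Qed.

Let pairing_fine (f : R -> R) : measurable_fun setT f ->
  (\int[lebesgue_measure]_x (c x * (f x)%:E) =
   \int[lebesgue_measure]_x (c' x * f x)%:E)%E.
Proof.
move=> mf; apply: ae_eq_integral => //.
- by apply: emeasurable_funM; [exact: measurable_concentration|exact/measurable_EFinP].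
- by apply/measurable_EFinP; exact: measurable_funM.
- have := integrable_ae measurableT integrable_concentration.
  by apply: filterS => x /(_ I) cx _; rewrite EFinM fineK.
Qed.

Let pairing_ge0 (M : R) (g : R -> R) : continuous g ->
  (forall x, 0 <= g x) -> (forall x, g x <= M) ->
  lebesgue_measure.-integrable setT (fun x => (c' x * g x)%:E) /\
  (\int[lebesgue_measure]_x (c' x * g x)%:E = (expR t * \int[heat t]_x g x)%:E)%E.
Proof.
move=> cg g0 gM.
have mg : measurable_fun setT g by exact: continuous_measurable_fun.
have E : (\int[lebesgue_measure]_x (c' x * g x)%:E = (expR t * \int[heat t]_x g x)%:E)%E.
  rewrite -pairing_fine// (concentration_integral cg g0 gM) EFinM fineK//.
  apply: integrable_fin_num => //; apply: (heat_integrable t mg (M := M)) => x.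
  by rewrite ger0_norm.
split => //; apply/integrableP; split.
  by apply/measurable_EFinP; exact: measurable_funM.
under eq_integral => x _.
  rewrite gee0_abs; last by rewrite lee_fin mulr_ge0// fine_ge0// concentration_ge0.
  over.
by rewrite E ltry.
Qed.

(** Write [f] as the difference of [f + M] and the constant [M], both nonnegative, bounded and
    continuous, with finite integrals against [c]. *)
Lemma concentration_pairing (M : R) (f : R -> R) : continuous f ->
  (forall x, `|f x| <= M) -> pairing c f = expR t * \int[heat t]_x f x.
Proof.
move=> cf fM.
have M0 : 0 <= M by rewrite (le_trans _ (fM 0)).
have mf : measurable_fun setT f by exact: continuous_measurable_fun.
have cfM : continuous (fun x => f x + M).
  by move=> x; apply: cvgD; [exact: cf|exact: cvg_cst].
have fM0 x : 0 <= f x + M.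
  by rewrite -lerBlDr sub0r; have := fM x; rewrite ler_norml => /andP[].
have fM2 x : f x + M <= M + M by rewrite lerD2r; exact: (le_trans (ler_norm _)).
have [i1 E1] := pairing_ge0 cfM fM0 fM2.
have [i2 E2] := @pairing_ge0 M (cst M) (fun x => cvg_cst _) (fun=> M0) (fun=> lexx _).
rewrite /pairing pairing_fine//.
under eq_integral => x _.
  rewrite (_ : c' x * f x = c' x * (f x + M) - c' x * M); last by ring.
  rewrite EFinB; over.
rewrite (integralB measurableT i1 i2) E1 E2 -EFinB/= -mulrBr; congr (_ * _).
rewrite -RintegralB//.
- by apply: eq_Rintegral => x _; rewrite addrK.
- apply: (heat_integrable t _ (M := M + M)); first exact: continuous_measurable_fun.
  by move=> x; rewrite ger0_norm.
- apply: (heat_integrable t _ (M := M)); first exact: measurable_cst.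
  by move=> x; rewrite ger0_norm.
Qed.

End fixed_time.
End concentration.

Theorem theorem1p3 (R : realType) (d : measure_display)
    (Omega : measurableType d) (P : probability Omega R)
    (tau : seq bool -> Omega -> R) (W : seq bool -> R -> Omega -> R)
    (X : nat -> R -> Omega -> R) (rho : forall n : nat, R -> n.-tuple R -> R) :
  binary_branching_bm P tau W ->
  (forall (k : nat) (t : R), 0 <= t -> measurable_fun setT (X k t)) ->
  labels_particles tau W X ->
  symmetric_densities P tau X rho ->
  solves_reaction_diffusion (average_concentration rho).
Proof.
move=> bbm mX labels dens.
(* The motion of the initial particle supplies the Brownian motion behind the semigroup law. *)
have heat_semigroup := heatD (bbm_motion bbm [::]).
have pairingE (f : R -> R) (M : R) (t : R) : 0 < t -> continuous f ->
    (forall x, `|f x| <= M) ->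
    pairing (average_concentration rho t) f = expR t * \int[heat t]_x f x.
  by move=> t0; exact: (concentration_pairing bbm mX labels dens t0).
split.
- move=> t t0 K cK; apply: (@integrableS _ _ _ _ setT) => //.
    by apply: closed_measurable; apply: compact_closed.
  exact: (integrable_concentration bbm mX labels dens t0).
- move=> phi phiT t t0.
  have [M phiM] := choice (test_function_bounded phiT).
  have dphi := test_function_derive phiT.
  have cphi := test_function_continuous phiT.
  have dF := heat_flow_derive heat_semigroup dphi phiM t0.
  rewrite (pairingE _ _ _ t0 (cphi 2) (phiM 2)) (pairingE _ _ _ t0 (cphi 0) (phiM 0)).
  (* The pairing is known at positive times, hence near [t]. In the product rule the exponential
     yields the growth term and the heat flow yields the diffusion term. *)
  apply: (@near_eq_is_derive _ _ _ (expR * (fun s => \int[heat s]_x derive1n 0 phi x))).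
    near=> s; rewrite (pairingE _ _ _ _ (cphi 0) (phiM 0))//.
    near: s; exact: lt_nbhsr.
  apply: is_derive_eq.
  rewrite /GRing.scale/=; ring.
- move=> phi phiT.
  have [M phiM] := choice (test_function_bounded phiT).
  have dphi := test_function_derive phiT.
  have cphi := test_function_continuous phiT.
  have F0 := heat_flow_cvg0 heat_semigroup dphi phiM.
  rewrite -[phi 0]mul1r -expR0.
  apply: cvg_trans (cvgM (cvg_at_right_filter (@continuous_expR R 0)) F0).
  apply: near_eq_cvg; near=> t.
  by rewrite (pairingE _ _ _ _ (cphi 0) (phiM 0)).
Unshelve. all: by end_near.
Qed.
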